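(* For all integers $n\geq0$ and $\alpha\geq1$, \begin{align*} p_{-7}\left(5^{2\alpha-1}n+\frac{13\cdot5^{2\alpha-1}+7}{24}\right)&\equiv0\pmod{5^{\alpha}},\\ p_{-7}\left(5^{2\alpha}n+\frac{17\cdot5^{2\alpha}+7}{24}\right)&\equiv0\pmod{5^{\alpha+1}},\\ p_{-7}\left(5^{2\alpha}n+\frac{61\cdot5^{2\alpha-1}+7}{24}\right)&\equiv0\pmod{5^{\alpha+1}},\\ p_{-7}\left(5^{2\alpha}n+\frac{109\cdot5^{2\alpha-1}+7}{24}\right)&\equiv0\pmod{5^{\alpha+1}}. \end{align*}
   Context: $p_{-7}(n)$ is the number of $7$-colored partitions of $n$, i.e. $\sum_{n\geq0}p_{-7}(n)q^n=\prod_{i\geq1}(1-q^i)^{-7}$. *)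

(* Defs.v *)
(* MathComp *)
From mathcomp Require Import all_boot.

Set Implicit Arguments.
Unset Strict Implicit.
Unset Printing Implicit Defensive.

(* A k-colored partition of n is a multiset of colored positive integers with
   sum n; its generating function is \prod_(i >= 1) (1 - q^i)^(-k).  The index
   (i, c) stands for the part i.+1 in color c, and m (i, c) is the
   multiplicity of this part.  Parts and multiplicities of a partition of n
   are at most n, so the bounds of the finite types lose nothing. *)
Definition colored_partitions (k n : nat) :
    {set {ffun 'I_n * 'I_k -> 'I_n.+1}} :=
  [set m : {ffun 'I_n * 'I_k -> 'I_n.+1} |
     \sum_(u : 'I_n * 'I_k) m u * u.1.+1 == n].

Definition num_colored_partitions (k n : nat) : nat :=
  #|colored_partitions k n|.

(* Main.v *)
From HB Require Import structures.
Require Import Defs.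
From mathcomp Require Import all_boot all_order all_algebra all_field.
From mathcomp Require Import boolp zify ring.

(* Write E(q) for Euler's product, E5 = E(q^5), E25 = E(q^25), x = q E25 / E and
   t = q E5^6 / E^6, so that x^6 = t(q) t(q^5). The pentagonal number theorem gives
   E = A - q E25 + q^2 C with A, C series in q^5; Jacobi's identity shows that E^3
   has no exponent congruent to 2 modulo 5, which forces A C = - E25^2. Taking the
   norm, i.e. the product over q -> w q with w^5 = 1, of this trinomial yields
     x^5 = t(q^5) (1 + 5 x + 15 x^2 + 25 x^3 + 25 x^4).
   Hence extracting the exponents divisible by 5 from x^k gives a polynomial in t,
   given by a recursion that controls the 5-adic valuations of its coefficients.
   Iterating, q^2 E5^7 times the generating function of the p(5^(2a-1) n + ...)
   and q E^7 times that of the p(5^(2a) n + ...) are polynomials in t, whose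
   coefficients acquire one more factor 5 every two steps. For the last two
   congruences only the t^2 term matters, and modulo 5 it is E^3 times a series
   in q^5; by Jacobi's identity E^3 has no exponent congruent to 2 or 4. *)

Set Implicit Arguments.
Unset Strict Implicit.
Unset Printing Implicit Defensive.

Import GRing.Theory.
Local Open Scope ring_scope.

(** * The ring of formal power series *)

Record fps (R : Type) := Fps { fcoef :> nat -> R }.

Lemma fpsP (R : Type) (f g : fps R) : f =1 g -> f = g.
Proof. by case: f g => [f] [g] /= /funext ->. Qed.

HB.instance Definition _ (R : Type) := gen_eqMixin (fps R).
HB.instance Definition _ (R : Type) := gen_choiceMixin (fps R).

Section Ring.
Variable R : comNzRingType.
Implicit Types (f g h : fps R) (p : {poly R}).

Definition fadd f g := Fps (fun n => f n + g n).
Definition fopp f := Fps (fun n => - f n).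
Definition fzero : fps R := Fps (fun=> 0).
Definition fone : fps R := Fps (fun n => (n == 0)%:R).
Definition fmul f g := Fps (fun n => \sum_(i < n.+1) f i * g (n - i)%N).

Fact faddA : associative fadd.
Proof. by move=> f g h; apply: fpsP => n /=; rewrite addrA. Qed.
Fact faddC : commutative fadd.
Proof. by move=> f g; apply: fpsP => n /=; rewrite addrC. Qed.
Fact fadd0 : left_id fzero fadd.
Proof. by move=> f; apply: fpsP => n /=; rewrite add0r. Qed.
Fact faddN : left_inverse fzero fopp fadd.
Proof. by move=> f; apply: fpsP => n /=; rewrite addNr. Qed.

HB.instance Definition _ := GRing.isZmodule.Build (fps R) faddA faddC fadd0 faddN.

(* Multiplication is transported from polynomials that agree with the series
   up to order [n]. *)
Definition ftrunc n f : {poly R} := \poly_(i < n.+1) f i.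

Lemma coef_ftrunc n f i : (i <= n)%N -> (ftrunc n f)`_i = f i.
Proof. by move=> le_in; rewrite coef_poly ltnS le_in. Qed.

Lemma fmul_poly n f g p p' :
  (forall i, (i <= n)%N -> p`_i = f i) -> (forall i, (i <= n)%N -> p'`_i = g i) ->
  forall i, (i <= n)%N -> (p * p')`_i = fmul f g i.
Proof.
move=> pf pg i le_in; rewrite coefM; apply: eq_bigr => j _.
by rewrite pf ?pg //; case: j => j /=; lia.
Qed.

Lemma fmulE n f g : fmul f g n = (ftrunc n f * ftrunc n g)`_n.
Proof. by rewrite (@fmul_poly n f g) // => i; exact: coef_ftrunc. Qed.

Fact fmulA : associative fmul.
Proof.
move=> f g h; apply: fpsP => n; have T k := @coef_ftrunc n k.
rewrite -(fmul_poly (T f) (fmul_poly (T g) (T h))) // mulrA.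
exact: (fmul_poly (fmul_poly (T f) (T g)) (T h)).
Qed.

Fact fmulC : commutative fmul.
Proof. by move=> f g; apply: fpsP => n; rewrite !fmulE mulrC. Qed.

Fact fmul1 : left_id fone fmul.
Proof.
move=> f; apply: fpsP => n /=; rewrite big_ord_recl /= mul1r subn0 big1 ?addr0 //.
by move=> i _; rewrite mul0r.
Qed.

Fact fmulDl : left_distributive fmul fadd.
Proof.
move=> f g h; apply: fpsP => n /=; rewrite -big_split /=.
by apply: eq_bigr => i _; rewrite mulrDl.
Qed.

Fact fone_neq0 : fone != fzero.
Proof.
apply/eqP => /(congr1 (fun f : fps R => f 0%N)) /= /eqP.
by rewrite oner_eq0.
Qed.

HB.instance Definition _ := GRing.Zmodule_isComNzRing.Build (fps R)
  fmulA fmulC fmul1 fmulDl fone_neq0.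

Lemma fcoefD f g n : (f + g) n = f n + g n. Proof. by []. Qed.
Lemma fcoefN f n : (- f) n = - f n. Proof. by []. Qed.
Lemma fcoefB f g n : (f - g) n = f n - g n. Proof. by []. Qed.
Lemma fcoef0 n : (0 : fps R) n = 0. Proof. by []. Qed.
Lemma fcoef1 n : (1 : fps R) n = (n == 0)%:R. Proof. by []. Qed.
Lemma fcoefM f g n : (f * g) n = \sum_(i < n.+1) f i * g (n - i)%N.
Proof. by []. Qed.
Lemma fcoef_sum (I : Type) (r : seq I) (P : pred I) (F : I -> fps R) n :
  (\sum_(i <- r | P i) F i) n = \sum_(i <- r | P i) F i n.
Proof. by elim/big_rec2: _ => // i y1 y2 _ <-. Qed.
Lemma fcoefMn f k n : (f *+ k) n = f n *+ k.
Proof. by elim: k => [|k IH]; rewrite ?mulr0n // !mulrS -IH. Qed.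

Definition fX : fps R := Fps (fun n => (n == 1)%:R).

Lemma fcoefXM f n : (fX * f) n = if n is m.+1 then f m else 0.
Proof.
rewrite fcoefM; case: n => [|n]; first by rewrite big_ord1 /= mul0r.
rewrite big_ord_recl /= mul0r add0r big_ord_recl /= mul1r subn1 big1 ?addr0 //.
by move=> i _; rewrite mul0r.
Qed.

Lemma fcoefXnM f k n : (fX ^+ k * f) n = if (n < k)%N then 0 else f (n - k)%N.
Proof.
elim: k n => [|k IH] n; first by rewrite mul1r subn0.
by rewrite exprS -mulrA fcoefXM; case: n => // n; rewrite IH.
Qed.

Lemma fcoefXn k n : (fX ^+ k) n = (n == k)%:R.
Proof.
rewrite -[fX ^+ k]mulr1 fcoefXnM fcoef1; case: ltnP => nk.
  by rewrite ltn_eqF.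
by congr (_ %:R); apply/eqP/eqP; lia.
Qed.

Lemma fXn_inj k f g : fX ^+ k * f = fX ^+ k * g -> f = g.
Proof.
move=> e; apply: fpsP => n; have := congr1 (fun h : fps R => h (n + k)%N) e.
by rewrite !fcoefXnM addnK ltnNge leq_addl.
Qed.

(** Congruence modulo [q^n], by which identities between infinite products reduce to finite ones. *)
Definition feq n f g := forall i, (i < n)%N -> f i = g i.

Lemma feq_refl n f : feq n f f. Proof. by []. Qed.
#[local] Arguments feq_refl {n f} i _.
Lemma feq_sym n f g : feq n f g -> feq n g f.
Proof. by move=> e i /e. Qed.
Lemma feq_trans n f g h : feq n f g -> feq n g h -> feq n f h.
Proof. by move=> e e' i lt_in; rewrite e ?e'. Qed.
Lemma feqW m n f g : (m <= n)%N -> feq n f g -> feq m f g.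
Proof. by move=> le_mn e i lt_im; apply: e; apply: leq_trans le_mn. Qed.
Lemma feqP f g : (forall n, feq n f g) -> f = g.
Proof. by move=> e; apply: fpsP => n; apply: (e n.+1). Qed.

Lemma feqM n f g f' g' : feq n f f' -> feq n g g' -> feq n (f * g) (f' * g').
Proof.
move=> e e' i lt_in; rewrite !fcoefM; apply: eq_bigr => j _.
by rewrite e ?e' //; case: j => j /=; lia.
Qed.
Lemma feqXn n f g k : feq n f g -> feq n (f ^+ k) (g ^+ k).
Proof. by move=> e; elim: k => // k IH; rewrite !exprS; apply: feqM. Qed.
Lemma feq_sum n (I : Type) (r : seq I) (F G : I -> fps R) :
  (forall i, feq n (F i) (G i)) ->
  feq n (\sum_(i <- r) F i) (\sum_(i <- r) G i).
Proof.
by move=> e i lt_in; rewrite !fcoef_sum; apply: eq_bigr => j _; apply: e.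
Qed.
Lemma feq_XnM m n f g : feq n f g -> feq (m + n) (fX ^+ m * f) (fX ^+ m * g).
Proof.
move=> e i lt_i; rewrite !fcoefXnM; case: ltnP => // le_mi; apply: e; lia.
Qed.

Lemma fexp_low f k n : f 0%N = 0 -> (n < k)%N -> (f ^+ k) n = 0.
Proof.
move=> f0; elim: k n => // k IH n lt_nk; rewrite exprS fcoefM big1 // => i _.
case: i => -[|i] /= lt_i; first by rewrite f0 mul0r.
by rewrite IH ?mulr0 //; lia.
Qed.

(* The geometric series in [1 - f]; an inverse of [f] when [f 0 = 1]. *)
Definition finv f := Fps (fun n => (\sum_(k < n.+1) (1 - f) ^+ k) n).

(** As [1 - f] has no constant term, its [k]-th power has no term below degree [k], so the geometric
    sum may be cut at any bound above the degree considered. *)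
Lemma finv_feq f n : f 0%N = 1 -> feq n (finv f) (\sum_(k < n) (1 - f) ^+ k).
Proof.
move=> f0 i lt_in /=; rewrite !fcoef_sum.
rewrite -(big_mkord xpredT (fun k => ((1 - f) ^+ k) i)).
rewrite -(big_mkord xpredT (fun k => ((1 - f) ^+ k) i)).
rewrite (@big_cat_nat _ _ _ i.+1 0 n) //= [X in _ = _ + X]big_nat.
rewrite [X in _ = _ + X]big1 ?addr0 //.
by move=> k /andP[lt_ik _]; rewrite fexp_low // fcoefB f0 subrr.
Qed.

Lemma mulfinv f : f 0%N = 1 -> f * finv f = 1.
Proof.
move=> f0; apply: feqP => n; apply: feq_trans (feqM feq_refl (finv_feq f0)) _.
have -> : f * (\sum_(k < n) (1 - f) ^+ k) = 1 - (1 - f) ^+ n.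
  by rewrite -[RHS]opprB subrX1 -mulNr opprB subKr.
move=> i lt_in; rewrite fcoefB fexp_low ?subr0 // fcoefB f0 subrr //.
Qed.

End Ring.

(** * The substitution of [q^5] for [q], and sections along residue classes modulo 5 *)

Section Stretch.
Variable R : comNzRingType.
Implicit Types (f g h : fps R).

Definition stretch f := Fps (fun n => if (5 %| n)%N then f (n %/ 5)%N else 0).

Fact stretch_is_zmod_morphism : zmod_morphism stretch.
Proof. by move=> f g; apply: fpsP => n /=; case: ifP; rewrite ?subr0 //= !fcoefB /=; case: ifP. Qed.

Fact stretch_is_monoid_morphism : monoid_morphism stretch.
Proof.
split; first by apply: fpsP => -[|n] //=; case: ifP => // /dvdnP[[|k]] // ->; rewrite mulnK.
move=> f g; apply: fpsP => n.
(* Up to degree [n], [stretch] is the substitution of ['X^5] in a truncation, so multiplicativity is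
   inherited from polynomials. *)
have H k i : (i <= n)%N -> (ftrunc n k \Po 'X^5)`_i = stretch k i.
  move=> le_in; rewrite coef_comp_poly_Xn //=; case: ifP => // _.
  by rewrite coef_ftrunc //; apply: leq_trans le_in; exact: leq_div.
rewrite -[RHS](fmul_poly (H f) (H g)) // -comp_polyM coef_comp_poly_Xn //=.
case: ifP => // _; rewrite (@fmul_poly R n f g) //; try exact: coef_ftrunc.
exact: leq_div.
Qed.

HB.instance Definition _ := GRing.isZmodMorphism.Build (fps R) (fps R) stretch
  stretch_is_zmod_morphism.
HB.instance Definition _ := GRing.isMonoidMorphism.Build (fps R) (fps R) stretch
  stretch_is_monoid_morphism.

Lemma stretchX : stretch (fX R) = fX R ^+ 5.
Proof.
apply: fpsP => n; rewrite fcoefXn /=; case: ifP => [/dvdnP[k ->]|].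
  by rewrite mulnK //; congr (_ %:R); apply/eqP/eqP; lia.
by case: eqP => // ->.
Qed.

Lemma feq_stretch n f g : feq n f g -> feq n (stretch f) (stretch g).
Proof.
move=> e i lt_in /=; case: ifP => // _; apply: e.
by apply: leq_ltn_trans lt_in; exact: leq_div.
Qed.

(** For [r = 0] this is Atkin's operator [U_5]; [pick5_shift] reduces the other residues to it. *)
Definition pick5 r f := Fps (fun n => f (5 * n + r)%N).

Fact pick5_is_zmod_morphism r : zmod_morphism (pick5 r).
Proof. by move=> f g; apply: fpsP. Qed.
HB.instance Definition _ r := GRing.isZmodMorphism.Build (fps R) (fps R) (pick5 r)
  (pick5_is_zmod_morphism r).

Lemma big_dvd5 (F : nat -> R) r n : (r < 5)%N ->
  \sum_(i < (5 * n + r).+1) (if (5 %| i)%N then F (i %/ 5)%N else 0) =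
  \sum_(i < n.+1) F i.
Proof.
move=> lt_r5.
have E k : (\sum_(i < (5 * k).+1) (if (5 %| i)%N then F (i %/ 5)%N else 0) =
  \sum_(i < k.+1) F i).
  elim: k => [|k IH]; first by rewrite muln0 !big_ord1.
  rewrite [RHS]big_ord_recr -IH /=.
  have -> : (5 * k.+1).+1 = (5 * k + 5).+1 by lia.
  rewrite addnS big_ord_recr /= !addnS !addn0 !big_ord_recr /=.
  have -> : (5 %| (5 * k).+1)%N = false by lia.
  have -> : (5 %| (5 * k).+2)%N = false by lia.
  have -> : (5 %| (5 * k).+3)%N = false by lia.
  have -> : (5 %| (5 * k).+4)%N = false by lia.
  have -> : (5 * k).+4.+1 = (5 * k.+1)%N by lia.
  by rewrite !addr0 !dvdn_mulr // !mulKn.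
rewrite -E; elim: r lt_r5 => [|r IH] lt_r; first by rewrite addn0.
rewrite addnS big_ord_recr /= IH; last by lia.
by case: ifP; rewrite ?addr0 //; lia.
Qed.

(** A series in [q^5] does not change residue classes of exponents, so sections are linear over such
    series. *)
Lemma pick5_mulr r f g : (r < 5)%N -> pick5 r (stretch g * f) = g * pick5 r f.
Proof.
move=> lt_r; apply: fpsP => n.
rewrite /= -(big_dvd5 (fun i => g i * f (5 * (n - i) + r)%N) n lt_r).
apply: eq_bigr => -[i lt_i] _ /=; case: ifP => [/dvdnP[k def_i]|]; last by rewrite mul0r.
by congr (_ * f _); move: lt_i; rewrite def_i mulnK //; lia.
Qed.

Lemma pick5_stretch g : pick5 0 (stretch g) = g.
Proof. by apply: fpsP => n; rewrite /= addn0 dvdn_mulr // mulKn. Qed.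

Definition inclass r f := forall n, n != r %[mod 5] -> f n = 0.

Lemma inclassN r f : inclass r f -> inclass r (- f).
Proof. by move=> cf n nr; rewrite fcoefN cf ?oppr0. Qed.

Lemma inclassM r s f g : inclass r f -> inclass s g -> inclass (r + s) (f * g).
Proof.
move=> cf cg n nrs; rewrite fcoefM big1 // => -[i lt_i] _ /=.
case: (eqVneq (i %% 5) (r %% 5))%N => [ir|ir]; last by rewrite cf ?mul0r.
by rewrite [g _]cg ?mulr0 //; apply: contra_neq nrs; lia.
Qed.

Lemma inclass_stretch f : inclass 0 (stretch f).
Proof. by move=> n /= /negPf; rewrite /dvdn mod0n => ->. Qed.

Lemma inclassXn k : inclass k (fX R ^+ k).
Proof. by move=> n nk; rewrite fcoefXn; case: (n =P k) nk => // ->; rewrite eqxx. Qed.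

Lemma pick5_inclass0 r s f : r != s %[mod 5] -> inclass s f -> pick5 r f = 0.
Proof.
move=> rs cf; apply: fpsP => n /=; rewrite cf //.
by apply: contra_neq rs; lia.
Qed.

End Stretch.

(** * The products [(q; q)_n], their inverses, and Euler's infinite product *)

Local Notation q := (fX int).

Definition qfact n : fps int := \prod_(i < n) (1 - q ^+ i.+1).
Definition iqfact n := finv (qfact n).

Lemma qfactS n : qfact n.+1 = qfact n * (1 - q ^+ n.+1).
Proof. exact: big_ord_recr. Qed.

Lemma qfact0 : qfact 0 = 1. Proof. exact: big_ord0. Qed.

Lemma fcoefM0 (f g : fps int) : (f * g) 0%N = f 0%N * g 0%N.
Proof. by rewrite fcoefM big_ord1. Qed.

Lemma qfact_coef0 n : qfact n 0%N = 1.
Proof. by elim: n => [|n IH]; rewrite ?qfact0 // qfactS fcoefM0 IH mul1r fcoefB fcoefXn subr0. Qed.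

Lemma mul_iqfact n : qfact n * iqfact n = 1.
Proof. exact/mulfinv/qfact_coef0. Qed.

Lemma iqfact0 : iqfact 0 = 1.
Proof. by rewrite -[LHS]mul1r -{1}qfact0 mul_iqfact. Qed.

Lemma iqfact_rec n : iqfact n = (1 - q ^+ n.+1) * iqfact n.+1.
Proof.
transitivity (iqfact n * (qfact n.+1 * iqfact n.+1)).
  by rewrite mul_iqfact mulr1.
by rewrite qfactS !mulrA [iqfact n * _]mulrC mul_iqfact mul1r.
Qed.

(** Coefficient [n] is already final after [n] factors, the later ones being 1 modulo [q^(n+1)]. *)
Definition euler : fps int := Fps (fun n => qfact n n).

Lemma feq_qfactS n : feq n.+1 (qfact n) (qfact n.+1).
Proof.
move=> i lt_i; rewrite qfactS mulrBr mulr1 fcoefB [qfact n * _]mulrC fcoefXnM.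
by rewrite lt_i subr0.
Qed.

Lemma feq_qfact m n : (m <= n)%N -> feq m.+1 (qfact m) (qfact n).
Proof.
elim: n => [|n IH]; first by rewrite leqn0 => /eqP ->.
rewrite leq_eqVlt => /orP[/eqP -> //|]; rewrite ltnS => le_mn.
by apply: feq_trans (IH le_mn) _; apply: feqW (@feq_qfactS n).
Qed.

Lemma feq_euler n : feq n.+1 euler (qfact n).
Proof. by move=> i lt_i /=; apply: (@feq_qfact i n). Qed.

Lemma euler_coef0 : euler 0%N = 1.
Proof. by rewrite /= qfact0. Qed.

(** * Euler's pentagonal number theorem *)

(** The exponents are the pentagonal numbers [k (3 k - 1) / 2] and [k (3 k + 1) / 2]. As [pterm 0]
    is 2, [pent] treats its constant term apart. *)
Definition pterm k : fps int :=
  (-1) ^+ k * (q ^+ (k * k + 'C(k, 2)) + q ^+ (k * k + 'C(k.+1, 2))).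

Definition pent n : fps int := 1 + \sum_(k < n) pterm k.+1.

Lemma pentS n : pent n.+1 = pent n + pterm n.+1.
Proof. by rewrite /pent big_ord_recr addrA. Qed.

Lemma bin2S k : 'C(k.+1, 2) = ('C(k, 2) + k)%N.
Proof. by rewrite binS bin1. Qed.

(* Shanks's finite form of the pentagonal number theorem. *)
Definition shanks n : fps int :=
  \sum_(s < n.+1) (-1) ^+ s * iqfact s * q ^+ (s * n + 'C(s.+1, 2)).

(** A telescoping sum: the summands are [1 - q^(n+1)] times the terms of [shanks n.+1], minus those
    of [shanks n]. *)
Lemma shanks_partial n k :
  \sum_(s < k.+1) (-1) ^+ s * iqfact s * q ^+ (s * n + 'C(s.+1, 2)) *
     ((1 - q ^+ n.+1) * q ^+ s - 1) =
  - ((-1) ^+ k * iqfact k * q ^+ (k * n.+1 + n.+1 + 'C(k.+1, 2))).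
Proof.
elim: k => [|k IH].
  by rewrite big_ord1 /= iqfact0 !mul0n !add0n !bin_small // addn0 !mulr1 !mul1r addrC addKr.
rewrite big_ord_recr /= IH (iqfact_rec k).
have -> : (k * n.+1 + n.+1 + 'C(k.+1, 2) = k.+1 * n + 'C(k.+1, 2) + k.+1)%N by nia.
have -> : (k.+1 * n + 'C(k.+2, 2) = k.+1 * n + 'C(k.+1, 2) + k.+1)%N.
  by rewrite [in LHS]bin2S addnA.
have -> : (k.+1 * n.+1 + n.+1 + 'C(k.+2, 2) =
           k.+1 * n + 'C(k.+1, 2) + k.+1 + n.+1 + k.+1)%N.
  by rewrite [in LHS]bin2S; nia.
rewrite (exprS (-1) k) !(exprD q (_ + _) _).
move: (q ^+ _) (q ^+ _) (q ^+ _) (q ^+ _) => a b c d.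
by ring.
Qed.

Lemma qfact_shanks n : qfact n * shanks n = pent n.
Proof.
elim: n => [|n IH].
  by rewrite qfact0 /shanks /pent big_ord1 big_ord0 iqfact0 !mul1r addr0.
(* The part of [shanks n.+1] that [shanks_partial] compares with [shanks n]; only its last term is
   left out. *)
pose W : fps int := \sum_(s < n.+1) (-1) ^+ s * iqfact s * q ^+ (s * n.+1 + 'C(s.+1, 2)).
have shW : shanks n.+1 =
    W + (-1) ^+ n.+1 * iqfact n.+1 * q ^+ (n.+1 * n.+1 + 'C(n.+2, 2)).
  by rewrite /shanks big_ord_recr.
have WE : (1 - q ^+ n.+1) * W =
    shanks n - (-1) ^+ n * iqfact n * q ^+ (n.+1 * n.+1 + 'C(n.+1, 2)).
  have -> : (n.+1 * n.+1 + 'C(n.+1, 2) = n * n.+1 + n.+1 + 'C(n.+1, 2))%N by lia.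
  rewrite -shanks_partial; apply/eqP; rewrite addrC -subr_eq; apply/eqP.
  rewrite mulr_sumr -sumrB; apply: eq_bigr => s _.
  have -> : (s * n.+1 + 'C(s.+1, 2) = s * n + 'C(s.+1, 2) + s)%N by nia.
  by rewrite exprD; ring.
have M := mul_iqfact n; have := mul_iqfact n.+1; rewrite qfactS => M1.
rewrite shW pentS /pterm -IH mulrDr -mulrA WE (exprS (-1)).
(* [Y] and [Z] are the two monomials of [pterm n.+1]. *)
move: (q ^+ (_ + 'C(n.+1, 2))) (q ^+ (_ + 'C(n.+2, 2))) => Y Z.
transitivity (qfact n * shanks n - (-1) ^+ n * (qfact n * iqfact n) * Y -
  (-1) ^+ n * (qfact n * (1 - q ^+ n.+1) * iqfact n.+1) * Z); first by ring.
by rewrite M M1; ring.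
Qed.

(** Apart from the term 1 at [s = 0], all exponents in [shanks n] exceed [n], so this factor is 1
    modulo [q^(n+1)] in [qfact_shanks]. *)
Lemma euler_pent n : feq n.+1 euler (pent n).
Proof.
apply: feq_trans (@feq_euler n) _; rewrite -qfact_shanks /shanks.
rewrite big_ord_recl /= iqfact0 mul0n add0n bin_small // !mulr1 -[X in feq _ X _]mulr1.
apply: feqM => // i lt_i; rewrite fcoefD -[X in X = _]addr0; congr (_ + _).
rewrite fcoef_sum big1 // => s _; rewrite mulrC fcoefXnM bin2S.
by rewrite ifT //; rewrite /bump /=; nia.
Qed.

Lemma pick5_sign r k (f : fps int) : (r < 5)%N ->
  pick5 r ((-1) ^+ k * f) = (-1) ^+ k * pick5 r f.
Proof. by move=> lt_r; rewrite -pick5_mulr // rmorph_sign. Qed.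

Lemma pick5_Xn r m : (r < 5)%N -> pick5 r (q ^+ (5 * m + r)) = q ^+ m.
Proof.
move=> lt_r; apply: fpsP => n; rewrite fcoefXn /= fcoefXn.
by congr (nat_of_bool _)%:R; lia.
Qed.

Lemma pick5_Xn0 r m : (r < 5)%N -> m != r %[mod 5] -> pick5 r (q ^+ m) = 0.
Proof.
move=> lt_r mr; apply: (pick5_inclass0 _ (@inclassXn _ m)).
by rewrite eq_sym.
Qed.

Lemma bin2_dbl k : (2 * 'C(k, 2) + k = k * k)%N.
Proof. by elim: k => // k IH; rewrite bin2S; nia. Qed.

Lemma bin2_5D m r : ('C(5 * m + r, 2) = 'C(r, 2) + 5 * (m * r) + 25 * 'C(m, 2) + 10 * m)%N.
Proof.
by have := (bin2_dbl (5 * m + r), bin2_dbl m, bin2_dbl r); case; case; nia.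
Qed.

Lemma pick5_pterm0 r k : (r < 5)%N ->
  (k * k + 'C(k, 2))%N != r %[mod 5] -> (k * k + 'C(k.+1, 2))%N != r %[mod 5] ->
  pick5 r (pterm k) = 0.
Proof.
by move=> lt_r ha hb; rewrite pick5_sign // raddfD /= !pick5_Xn0 // addr0 mulr0.
Qed.

(** Generalized pentagonal numbers are 0, 1 or 2 modulo 5. *)
Lemma pick5_pent r n : (2 < r < 5)%N -> pick5 r (pent n) = 0.
Proof.
move=> /andP[lt2r ltr5]; rewrite raddfD /= raddf_sum.
have -> : pick5 r (1 : fps int) = 0 by rewrite -(expr0 q) pick5_Xn0 //; lia.
rewrite add0r big1 //= => k _.
have -> : k.+1 = (5 * (k.+1 %/ 5) + k.+1 %% 5)%N by lia.
move: (_ %/ 5)%N (_ %% 5)%N (ltn_pmod k.+1 (isT : 0 < 5)%N) => m s lt_s.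
apply: pick5_pterm0 => //; rewrite ?bin2S bin2_5D.
all: by move: s lt_s => [|[|[|[|[|]]]]] //= _; rewrite ?bin2S bin0n; lia.
Qed.

Lemma pick5_1_pterm0 n s : (s \in [:: 2; 3; 5])%N -> pick5 1 (pterm (5 * n + s)) = 0.
Proof.
move=> s_in; apply: pick5_pterm0 => //; rewrite ?bin2S bin2_5D.
all: by move: s_in; rewrite !inE => /or3P[] /eqP ->; rewrite ?bin2S bin0n; lia.
Qed.

Lemma stretch_Xn k : stretch (q ^+ k) = q ^+ (5 * k).
Proof. by rewrite rmorphXn /= stretchX -exprM. Qed.

(** With [m = n + 1], the larger pentagonal number of index [5 m - 1] and the smaller one of index
    [5 m + 1] are 1 plus 25 times the two of index [m]; the remaining two are not 1 modulo 5. *)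
Lemma pick5_1_pterm n :
  pick5 1 (pterm (5 * n + 4) + pterm (5 * n + 6)) = - stretch (pterm n.+1).
Proof.
rewrite raddfD /= !pick5_sign // !raddfD /= rmorphM rmorph_sign rmorphD /= !stretch_Xn.
have e1 : ((5 * n + 4) * (5 * n + 4) + 'C((5 * n + 4).+1, 2) =
           5 * (5 * (n.+1 * n.+1 + 'C(n.+1, 2))) + 1)%N.
  by rewrite !bin2S bin2_5D; rewrite !bin2S bin0n; lia.
have e2 : ((5 * n + 6) * (5 * n + 6) + 'C(5 * n + 6, 2) =
           5 * (5 * (n.+1 * n.+1 + 'C(n.+2, 2))) + 1)%N.
  by rewrite !bin2S bin2_5D; rewrite !bin2S bin0n; lia.
rewrite e1 e2 !pick5_Xn //.
rewrite (pick5_Xn0 (r := 1)) //; last by rewrite bin2_5D !bin2S bin0n; lia.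
rewrite (pick5_Xn0 (r := 1)) //; last by rewrite bin2S bin2_5D !bin2S bin0n; lia.
have s4 : (-1) ^+ (5 * n + 4) = (-1) ^+ n :> fps int.
  by rewrite -signr_odd oddD oddM /= addbF signr_odd.
have s6 : (-1) ^+ (5 * n + 6) = (-1) ^+ n :> fps int.
  by rewrite -signr_odd oddD oddM /= addbF signr_odd.
by rewrite s4 s6 exprS; ring.
Qed.

(** Stopping at index [5 n + 1] keeps whole the pairs matched by [pick5_1_pterm]. *)
Lemma pick5_1_pent n : pick5 1 (pent (5 * n).+1) = - stretch (pent n).
Proof.
elim: n => [|n IH].
  rewrite /pent big_ord_recl !big_ord0 /= !addr0 /pterm expr1 mulN1r !rmorph1.
  rewrite raddfD raddfN raddfD /= -(expr0 q).
  rewrite (pick5_Xn0 (r := 1) (m := 0)) // (@pick5_Xn 1 0) // (pick5_Xn0 (r := 1) (m := 2)) //.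
  by rewrite addr0 add0r.
have -> : pent (5 * n.+1).+1 = pent (5 * n).+1 + pterm (5 * n + 2) + pterm (5 * n + 3) +
   pterm (5 * n + 5) + (pterm (5 * n + 4) + pterm (5 * n + 6)).
  have -> : (5 * n.+1 = (5 * n).+4.+1)%N by lia.
  by rewrite 5!pentS !(addnS _ _.+1) !addn1; ring.
rewrite raddfD /= pick5_1_pterm [pent n.+1]pentS (raddfD (@stretch int)) /= opprD -IH.
by rewrite !raddfD /= !pick5_1_pterm0 // !addr0.
Qed.

(** * Jacobi's identity for the cube of Euler's function *)

(** The inverse of [(q; q)_(m-1)]; the value 0 at [m = 0] makes [iqpred_rec] hold there too. *)
Definition iqpred m := if m is m'.+1 then iqfact m' else 0.

Lemma iqpred_rec m : iqpred m = (1 - q ^+ m) * iqpred m.+1.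
Proof. by case: m => [|m] /=; [rewrite subrr mul0r | exact: iqfact_rec]. Qed.

(* The Gaussian binomial coefficient [2n+1 choose n-k], which is 0 for [k > n]. *)
Definition gbin n k : fps int :=
  qfact (2 * n).+1 * iqpred (n.+1 - k) * iqfact (n.+1 + k).

Lemma gbin_small n k : (n < k)%N -> gbin n k = 0.
Proof. by move=> lt_nk; rewrite /gbin (eqP lt_nk) mulr0 mul0r. Qed.

(** The case of index 0 in the recurrence of [gbin_recS]: by symmetry of the binomials, the
    neighbour of index -1 is [gbin n 0] itself. *)
Lemma gbin_rec0 n : gbin n.+1 0 =
  (1 + q ^+ n.+1 + q ^+ (2 * n).+2) * gbin n 0 + q ^+ n.+2 * gbin n 1.
Proof.
rewrite /gbin subn1 !subn0 /= addn1 !addn0 mulnS !add2n !qfactS.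
rewrite (iqpred_rec n) /= (iqfact_rec n) (iqfact_rec n.+1).
rewrite !mul2n -!addnn !exprS !exprD.
by move: (q ^+ n) => x; ring.
Qed.

(** Two q-Pascal steps, from row [2 n + 1] to row [2 n + 3], checked over a common denominator; at
    [k = n] two of the terms vanish. *)
Lemma gbin_recS n k : (k <= n)%N -> gbin n.+1 k.+1 =
  (1 + q ^+ (2 * n).+2) * gbin n k.+1 + q ^+ (n - k) * gbin n k +
  q ^+ (n + k).+3 * gbin n k.+2.
Proof.
move=> le_kn; rewrite /gbin.
have -> : (n.+2 - k.+1 = (n - k).+1)%N by lia.
have -> : (n.+1 - k.+1 = n - k)%N by lia.
have -> : (n.+1 - k = (n - k).+1)%N by lia.
have -> : (n.+1 - k.+2 = (n - k).-1)%N by lia.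
have -> : (n.+2 + k.+1 = (n + k).+3)%N by lia.
have -> : (n.+1 + k.+1 = (n + k).+2)%N by lia.
have -> : (n.+1 + k.+2 = (n + k).+3)%N by lia.
rewrite addSn.
have -> : (2 * n.+1 = (2 * n).+2)%N by lia.
case def_m: (n - k)%N => [|m] /=.
  have -> : (n + k = 2 * n)%N by lia.
  by rewrite iqfact0 !(mulr0, mul0r, addr0, add0r, mulr1, mul1r) !mul_iqfact.
rewrite -[iqfact m]/(iqpred m.+1) -/(iqfact m.+1) (iqpred_rec m) (iqpred_rec m.+1) /=.
rewrite (iqfact_rec (n + k).+1) (iqfact_rec (n + k).+2) !qfactS.
have -> : (2 * n = m + (n + k).+1)%N by lia.
move: (n + k)%N => w; rewrite !exprS !exprD !exprS.
by move: (q ^+ m) (q ^+ w) => x y; ring.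
Qed.

Lemma jacobi_partial n m : (m <= n.+1)%N ->
  \sum_(k < m.+1) (-1) ^+ k * (2 * k + 1)%:R * q ^+ 'C(k.+1, 2) *
     (gbin n.+1 k - (1 - q ^+ n.+1) ^+ 2 * gbin n k) =
  (-1) ^+ m * q ^+ n.+1 * ((2 * m + 3)%:R * q ^+ 'C(m.+1, 2) * gbin n m +
     (2 * m + 1)%:R * q ^+ 'C(m.+2, 2) * gbin n m.+1).
Proof.
have dbl : q ^+ (2 * n).+2 = (q ^+ n.+1) ^+ 2 by rewrite -exprM; congr (_ ^+ _); lia.
elim: m => [_|m IH lt_mn].
  by rewrite big_ord1 /= gbin_rec0 dbl bin_small // binn !(exprS q); ring.
rewrite big_ord_recr /= IH 1?ltnW // gbin_recS // dbl.
have e1 : q ^+ 'C(m.+2, 2) * q ^+ (n - m) = q ^+ 'C(m.+1, 2) * q ^+ n.+1.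
  by rewrite -!exprD bin2S; congr (_ ^+ _); lia.
have e2 : q ^+ 'C(m.+2, 2) * q ^+ (n + m).+3 = q ^+ 'C(m.+3, 2) * q ^+ n.+1.
  by rewrite -!exprD [in RHS]bin2S; congr (_ ^+ _); lia.
move: (gbin n m) (gbin n m.+1) (gbin n m.+2) => g0 g1 g2.
transitivity ((-1) ^+ m * q ^+ n.+1 *
 ((2 * m + 3)%:R * q ^+ 'C(m.+1, 2) * g0 + (2 * m + 1)%:R * q ^+ 'C(m.+2, 2) * g1) +
  (-1) ^+ m.+1 * (2 * m.+1 + 1)%:R *
   (2 * q ^+ 'C(m.+2, 2) * q ^+ n.+1 * g1 + (q ^+ 'C(m.+2, 2) * q ^+ (n - m)) * g0 +
    (q ^+ 'C(m.+2, 2) * q ^+ (n + m).+3) * g2)); first by ring.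
by rewrite e1 e2 (exprS (-1)); ring.
Qed.

(** A finite form of Jacobi's identity: as [n] grows, the Gaussian binomials tend to [1 / E] and the
    right-hand side to [E^2]. *)
Lemma jacobi_finite n :
  \sum_(k < n.+1) (-1) ^+ k * (2 * k + 1)%:R * q ^+ 'C(k.+1, 2) * gbin n k =
  qfact n ^+ 2.
Proof.
elim: n => [|n IH].
  by rewrite big_ord1 /gbin /= bin_small // qfact0 iqfact0 !mulr1 !mul1r mul_iqfact expr1n.
have := @jacobi_partial n n.+1 (leqnn _).
rewrite (@gbin_small n n.+1) // (@gbin_small n n.+2) // !(mulr0, addr0); under eq_bigr do rewrite mulrBr [X in _ - X]mulrCA.
rewrite sumrB -mulr_sumr => /eqP; rewrite subr_eq0 => /eqP ->.
by rewrite big_ord_recr /= gbin_small // mulr0 addr0 IH qfactS exprMn mulrC.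
Qed.

Definition jac n : fps int :=
  \sum_(k < n.+1) (-1) ^+ k * (2 * k + 1)%:R * q ^+ 'C(k.+1, 2).

Lemma euler_gbin n k : (k <= n)%N -> feq (n - k).+1 (euler * gbin n k) 1.
Proof.
move=> le_kn; rewrite /gbin.
have -> : (n.+1 - k = (n - k).+1)%N by lia.
apply: (@feq_trans _ _ _ (qfact (n - k) * (qfact (n.+1 + k) * iqfact (n - k) * iqfact (n.+1 + k)))).
  apply: feqM; first exact: feq_euler.
  apply: feqM => //; apply: feqM => //; apply: feq_sym.
  by apply: (feqW _ (@feq_qfact (n.+1 + k) (2 * n).+1 _)); lia.
rewrite mulrAC mulrCA mulrC -!mulrA mul_iqfact mulr1.
by rewrite mul_iqfact.
Qed.

Lemma euler_jac n : feq n.+1 (euler ^+ 3) (jac n).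
Proof.
rewrite exprS; apply: (@feq_trans _ _ _ (euler * qfact n ^+ 2)).
  by apply: feqM => //; apply: feqXn; exact: feq_euler.
rewrite -jacobi_finite mulr_sumr; apply: feq_sum => k; rewrite mulrCA.
rewrite -[X in feq _ _ X]mulr1 -!mulrA; apply: feqM => //; apply: feqM => //.
have le_kn : (k <= n)%N by rewrite -ltnS.
(* [euler_gbin] loses [k] orders of precision; the factor [q ^+ 'C(k.+1, 2)] restores them. *)
apply: (feqW _ (feq_XnM (m := 'C(k.+1, 2)) (euler_gbin le_kn))).
have : (k <= 'C(k.+1, 2))%N by rewrite bin2S leq_addl.
by move: le_kn; lia.
Qed.

(** Triangular numbers are 0, 1 or 3 modulo 5. *)
Lemma pick5_euler3 r : r \in [:: 2; 4]%N -> pick5 r (euler ^+ 3) = 0.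
Proof.
move=> r24; apply: fpsP => n; rewrite -[LHS]/((euler ^+ 3) (5 * n + r)%N) (@euler_jac (5 * n + r)) //.
transitivity (pick5 r (jac (5 * n + r)) n) => //.
have lt_r : (r < 5)%N by move: r24; rewrite !inE => /orP[] /eqP ->.
rewrite raddf_sum big1 //= => k _.
rewrite -mulrA pick5_sign //.
have -> : (2 * k + 1)%:R = stretch ((2 * k + 1)%:R : fps int) by rewrite rmorph_nat.
rewrite pick5_mulr // pick5_Xn0 ?mulr0 //.
have -> : (k : nat) = (5 * (k %/ 5) + k %% 5)%N by lia.
move: (k %/ 5)%N (k %% 5)%N (ltn_pmod k (isT : 0 < 5)%N) => m s lt_s.
by move: r24; rewrite !inE => /orP[] /eqP ->;
  rewrite bin2S bin2_5D; move: s lt_s => [|[|[|[|[|]]]]] //= _; rewrite ?bin2S bin0n; lia.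
Qed.

(** * The 5-dissection *)

Lemma dissection (f : fps int) :
  f = stretch (pick5 0 f) + q * stretch (pick5 1 f) + q ^+ 2 * stretch (pick5 2 f) +
      q ^+ 3 * stretch (pick5 3 f) + q ^+ 4 * stretch (pick5 4 f).
Proof.
apply: fpsP => n; rewrite !fcoefD -[q * _]/(q ^+ 1 * _) !fcoefXnM.
have -> : (n = 5 * (n %/ 5) + n %% 5)%N by lia.
move: (n %/ 5)%N (n %% 5)%N (ltn_pmod n (isT : 0 < 5)%N) => m s lt_s.
have S t (g : fps int) : (t < 5)%N ->
    (if (5 * m + s < t)%N then 0 else stretch g (5 * m + s - t)%N) =
    if s == t then g m else 0.
  move=> lt_t /=; case: ltnP => [lt_mst|le_tms]; first by case: eqP lt_mst => //; lia.
  case: eqP => [->|st]; first by rewrite addnK dvdn_mulr // mulKn.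
  by rewrite ifF //; lia.
have S0 g := S 0%N g isT; rewrite ltn0 subn0 in S0; rewrite S0 !S //.
by move: s lt_s {S S0} => [|[|[|[|[|]]]]] //= _; rewrite ?addr0 ?add0r.
Qed.

Lemma pick5_sX r (g : fps int) m : (r < 5)%N ->
  pick5 r (stretch g * q ^+ m) = if m == r %[mod 5] then g * pick5 r (q ^+ m) else 0.
Proof.
move=> lt_r; rewrite pick5_mulr //; case: eqP => // /eqP mr.
by rewrite pick5_Xn0 ?mulr0.
Qed.

Definition euler_0 := pick5 0 euler.
Definition euler_2 := pick5 2 euler.

Lemma pick5_euler_1 : pick5 1 euler = - stretch euler.
Proof.
apply: fpsP => n; rewrite -[LHS]/(euler (5 * n + 1)%N).
rewrite (@euler_pent (5 * n).+1); last by rewrite addn1.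
by rewrite -[LHS]/(pick5 1 (pent (5 * n).+1) n) pick5_1_pent !fcoefN (feq_stretch (@euler_pent n)).
Qed.

Lemma pick5_euler_34 r : (2 < r < 5)%N -> pick5 r euler = 0.
Proof.
move=> r34; apply: fpsP => n; rewrite -[LHS]/(euler (5 * n + r)%N).
rewrite (@euler_pent (5 * n + r)) // -[LHS]/(pick5 r (pent (5 * n + r)) n).
by rewrite pick5_pent.
Qed.

Lemma euler_dissection :
  euler = stretch euler_0 - q * stretch (stretch euler) + q ^+ 2 * stretch euler_2.
Proof.
rewrite [LHS]dissection pick5_euler_1 (@pick5_euler_34 3) // (@pick5_euler_34 4) // !rmorph0 !mulr0 !addr0.
by rewrite rmorphN mulrN.
Qed.

Lemma mulf_inj (f g h : fps int) : f 0%N = 1 -> f * g = f * h -> g = h.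
Proof.
move=> f0 e; rewrite -[g]mul1r -[h]mul1r -(mulfinv f0) [f * _]mulrC.
by rewrite -!mulrA e.
Qed.

(** In the cube of the dissection, the class of 2 modulo 5 has the coefficient [3 A (A C + B^2)]. It
    vanishes by Jacobi's identity, and 3 and [A] cancel. *)
Lemma euler_02 : euler_0 * euler_2 = - stretch euler ^+ 2.
Proof.
have := @pick5_euler3 2 isT; rewrite {1}euler_dissection.
set A := euler_0; set B := stretch euler; set C := euler_2.
have -> : (stretch A - q * stretch B + q ^+ 2 * stretch C) ^+ 3 =
  stretch (A ^+ 3) * q ^+ 0 + stretch (- 3 * A ^+ 2 * B) * q ^+ 1 +
  stretch (3 * A * (A * C + B ^+ 2)) * q ^+ 2 +
  stretch (- B ^+ 3 - 6 * A * B * C) * q ^+ 3 +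
  stretch (3 * A * C ^+ 2 + 3 * B ^+ 2 * C) * q ^+ 4 +
  stretch (- 3 * B * C ^+ 2) * q ^+ 5 + stretch (C ^+ 3) * q ^+ 6.
  by rewrite !(rmorphD, rmorphN, rmorphM, rmorphXn, rmorph_nat) /=; ring.
rewrite !(raddfD (@pick5 int 2)) /= !pick5_sX // !add0r !addr0 (@pick5_Xn 2 0) // mulr1.
rewrite -mulrA => e.
have A0 : A 0%N = 1 by exact: euler_coef0.
apply/eqP; rewrite -subr_eq0 opprK; apply/eqP; apply: (mulf_inj A0); rewrite mulr0.
apply: fpsP => n; apply/eqP.
suff: (A * (A * C + B ^+ 2) *+ 3) n == 0 by rewrite fcoefMn Num.Theory.mulrn_eq0.
by rewrite -mulr_natl e.
Qed.

(** * The modular equation of degree 5 *)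

Section Norm.
Variable K : comNzRingType.
Implicit Types (w : K) (f g : fps K).

Definition fconst w : fps K := Fps (fun n => if n == 0 then w else 0).

Lemma fcoef_constM w f n : (fconst w * f) n = w * f n.
Proof.
by rewrite fcoefM big_ord_recl /= subn0 big1 ?addr0 // => i _; rewrite mul0r.
Qed.

Fact fconst_is_zmod_morphism : zmod_morphism fconst.
Proof. by move=> v w; apply: fpsP => -[|n] //; rewrite /= subrr. Qed.
Fact fconst_is_monoid_morphism : monoid_morphism fconst.
Proof.
split; first by apply: fpsP => -[|n].
by move=> v w; apply: fpsP => -[|n]; rewrite fcoef_constM //= mulr0.
Qed.
HB.instance Definition _ := GRing.isZmodMorphism.Build K (fps K) fconst
  fconst_is_zmod_morphism.
HB.instance Definition _ := GRing.isMonoidMorphism.Build K (fps K) fconst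
  fconst_is_monoid_morphism.

Definition twist w f : fps K := Fps (fun n => w ^+ n * f n).

Fact twist_is_zmod_morphism w : zmod_morphism (twist w).
Proof. by move=> f g; apply: fpsP => n; rewrite /= mulrBr. Qed.
Fact twist_is_monoid_morphism w : monoid_morphism (twist w).
Proof.
split; first by apply: fpsP => -[|n]; rewrite /= ?mulr1 ?mulr0.
move=> f g; apply: fpsP => n; rewrite fcoefM /= mulr_sumr.
apply: eq_bigr => -[i lt_i] _ /=; rewrite mulrACA -exprD subnKC //.
Qed.
HB.instance Definition _ w := GRing.isZmodMorphism.Build (fps K) (fps K) (twist w)
  (twist_is_zmod_morphism w).
HB.instance Definition _ w := GRing.isMonoidMorphism.Build (fps K) (fps K) (twist w)
  (twist_is_monoid_morphism w).

Lemma twist_Xn w m : twist w (fX K ^+ m) = fconst w ^+ m * fX K ^+ m.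
Proof.
rewrite -rmorphXn; apply: fpsP => n; rewrite fcoef_constM /= fcoefXn.
by case: eqP => [->|]; rewrite ?mulr0.
Qed.

Lemma twist_inclass w r f : w ^+ 5 = 1 -> inclass r f ->
  twist w f = fconst w ^+ r * f.
Proof.
move=> w5 cf; rewrite -rmorphXn; apply: fpsP => n; rewrite fcoef_constM /=.
have [nr|nr] := eqVneq (n %% 5)%N (r %% 5)%N; last by rewrite cf ?mulr0.
by rewrite -(expr_mod _ w5) nr expr_mod.
Qed.

Lemma feq_twist w n f g : feq n f g -> feq n (twist w f) (twist w g).
Proof. by move=> e i /e /= ->. Qed.

(** For a primitive fifth root of unity [w], the product of the conjugates [f(w^j q)]. *)
Definition norm5 w f := f * twist w f * twist (w ^+ 2) f * twist (w ^+ 3) f * twist (w ^+ 4) f.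

Lemma norm5M w f g : norm5 w (f * g) = norm5 w f * norm5 w g.
Proof. by rewrite /norm5 !rmorphM /=; ring. Qed.

Lemma feq_norm5 w n f g : feq n f g -> feq n (norm5 w f) (norm5 w g).
Proof. by move=> e; do 4! [apply: feqM; last exact: feq_twist]. Qed.

Variable w : K.
Hypothesis w_cyclo : 1 + w + w ^+ 2 + w ^+ 3 + w ^+ 4 = 0.

Let w4 : w ^+ 4 = - (1 + w + w ^+ 2 + w ^+ 3).
Proof. by apply/eqP; rewrite -addr_eq0 addrC w_cyclo. Qed.

Let w5 : w ^+ 5 = 1. Proof. by ring: w4. Qed.

(** If 5 divides [m] the five conjugates coincide; otherwise [w^m] satisfies the same cyclotomic
    relation as [w]. *)
Lemma norm5_factor m : norm5 w (1 - fX K ^+ m) =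
  if (5 %| m)%N then (1 - fX K ^+ m) ^+ 5 else 1 - fX K ^+ (5 * m).
Proof.
rewrite /norm5 !rmorphB !rmorph1 /= !twist_Xn !rmorphXn /=.
set W := fconst w; have W5 : W ^+ 5 = 1 by rewrite -rmorphXn /= w5 rmorph1.
have W4 : W ^+ 4 = - (1 + W + W ^+ 2 + W ^+ 3).
  by rewrite -rmorphXn /= w4 rmorphN !rmorphD rmorph1 !rmorphXn.
rewrite !(exprAC W _ m) [(5 * m)%N]mulnC exprM.
move: (fX K ^+ m) => x; case: ifP => [/dvdnP[k ->]|m5].
  by rewrite mulnC exprM W5 !expr1n; ring.
have y4 : (W ^+ m) ^+ 4 = - (1 + W ^+ m + (W ^+ m) ^+ 2 + (W ^+ m) ^+ 3).
  rewrite -(expr_mod m W5); move: m5; rewrite /dvdn.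
  by case: (m %% 5)%N (ltn_pmod m (isT : 0 < 5)%N) => [|[|[|[|[|]]]]] //= _ _; ring: W4.
by move: (W ^+ m) y4 => y y4; ring: y4.
Qed.

(** The conjugates are [f + w^j g + w^(2j) h]. Under [f h = - g^2], both sides equal
    [f^5 + 11 g^5 + h^5]. *)
Lemma norm5_trinomial f g h : inclass 0 f -> inclass 1 g -> inclass 2 h ->
  f * h = - g ^+ 2 ->
  norm5 w (f + g + h) = (f + g + h) ^+ 5 - 5 * g * (f + g + h) ^+ 4 +
    15 * g ^+ 2 * (f + g + h) ^+ 3 - 25 * g ^+ 3 * (f + g + h) ^+ 2 +
    25 * g ^+ 4 * (f + g + h).
Proof.
move=> cf cg ch fh; rewrite /norm5 !rmorphD /=.
have T j : twist (w ^+ j) (f + g + h) =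
    f + fconst w ^+ j * g + fconst w ^+ (2 * j) * h.
  have wj5 : (w ^+ j) ^+ 5 = 1 by rewrite exprAC w5 expr1n.
  rewrite !rmorphD /= (twist_inclass wj5 cf) (twist_inclass wj5 cg) (twist_inclass wj5 ch).
  by rewrite expr0 mul1r expr1 rmorphXn /= -exprM mulnC.
rewrite -!rmorphD /= -[w in twist w _]expr1 !T.
have W4 : fconst w ^+ 4 = - (1 + fconst w + fconst w ^+ 2 + fconst w ^+ 3).
  by rewrite -rmorphXn /= w4 rmorphN !rmorphD rmorph1 !rmorphXn.
by move: (fconst w) W4 => W W4; ring: W4 fh.
Qed.

End Norm.

Section Lift.
Variable K : comNzRingType.

(** Norms require a fifth root of unity, hence this change of coefficients; over [algC] it is
    injective, so identities descend to the integers. *)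
Definition flift (f : fps int) : fps K := Fps (fun n => (f n)%:~R).

Fact flift_is_zmod_morphism : zmod_morphism flift.
Proof. by move=> f g; apply: fpsP => n; rewrite /= rmorphB. Qed.
Fact flift_is_monoid_morphism : monoid_morphism flift.
Proof.
split; first by apply: fpsP => -[|n].
move=> f g; apply: fpsP => n; rewrite fcoefM /= rmorph_sum.
by apply: eq_bigr => i _; rewrite rmorphM.
Qed.
HB.instance Definition _ := GRing.isZmodMorphism.Build (fps int) (fps K) flift
  flift_is_zmod_morphism.
HB.instance Definition _ := GRing.isMonoidMorphism.Build (fps int) (fps K) flift
  flift_is_monoid_morphism.

Lemma flift_Xn m : flift (fX int ^+ m) = fX K ^+ m.
Proof. by apply: fpsP => n; rewrite /flift /= !fcoefXn; case: eqP. Qed.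

Lemma feq_flift n f g : feq n f g -> feq n (flift f) (flift g).
Proof. by move=> e i /e /= ->. Qed.

Lemma inclass_flift r f : inclass r f -> inclass r (flift f).
Proof. by move=> cf n /cf /= ->. Qed.

End Lift.


(** In each block of five factors, four norms are stretched factors and the last is a fifth power.
    The extra [stretch (stretch (qfact m))] completes the former to [stretch (qfact (5 * m))]. *)
Lemma norm5_qfact (K : comNzRingType) (w : K) m :
  1 + w + w ^+ 2 + w ^+ 3 + w ^+ 4 = 0 ->
  norm5 w (flift K (qfact (5 * m))) * flift K (stretch (stretch (qfact m))) =
  flift K (stretch (qfact (5 * m)) * stretch (qfact m) ^+ 5).
Proof.
move=> w_cyclo; elim: m => [|m IH].
  by rewrite qfact0 !rmorph1 /norm5 !rmorph1 !mulr1 expr1n mulr1 rmorph1.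
have F k : norm5 w (flift K (1 - q ^+ k)) =
    flift K (if (5 %| k)%N then (1 - q ^+ k) ^+ 5 else 1 - q ^+ (5 * k)).
  rewrite rmorphB rmorph1 /= flift_Xn norm5_factor //.
  case: ifP => _; first by rewrite rmorphXn rmorphB rmorph1 /= flift_Xn.
  by rewrite rmorphB rmorph1 /= flift_Xn.
have S k : stretch (1 - q ^+ k) = 1 - q ^+ (5 * k).
  by rewrite rmorphB rmorph1 /= stretch_Xn.
(* Existentials with an equation keep [g] and [h] opaque until they are rewritten. *)
have [g Eg] : exists g : nat -> fps int, g = fun j => 1 - q ^+ (5 * m + j) by eexists.
have Q5 : qfact (5 * m.+1) = qfact (5 * m) * (g 1%N * g 2 * g 3 * g 4 * g 5).
  have -> : (5 * m.+1 = (5 * m).+4.+1)%N by lia.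
  by rewrite Eg !addnS addn0 !qfactS -!mulrA.
have [h Eh] : exists h : fps int, h = 1 - q ^+ m.+1 by eexists.
have g5 : g 5%N = stretch h.
  by rewrite Eg Eh S; congr (1 - _ ^+ _); lia.
have N j : (0 < j < 5)%N -> norm5 w (flift K (g j)) = flift K (stretch (g j)).
  by move=> lt_j; rewrite Eg F S ifF //; lia.
have N5 : norm5 w (flift K (stretch h)) = flift K (stretch h ^+ 5).
  by rewrite -g5 Eg F ifT //; lia.
rewrite Q5 g5 qfactS -Eh.
transitivity (norm5 w (flift K (qfact (5 * m))) * flift K (stretch (stretch (qfact m))) *
  (norm5 w (flift K (g 1%N)) * norm5 w (flift K (g 2)) * norm5 w (flift K (g 3)) *
   norm5 w (flift K (g 4)) * norm5 w (flift K (stretch h)) *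
   flift K (stretch (stretch h)))).
  rewrite !(rmorphM (flift K)) /= !norm5M !(rmorphM (@stretch int)) (rmorphM (flift K)).
  by move: (norm5 _ _) (norm5 _ _) => *; ring.
rewrite IH N5 !N // -!(rmorphM (flift K)); congr flift.
by rewrite !(rmorphM (@stretch int)) /=; ring.
Qed.

Lemma euler_norm5 (K : comNzRingType) (w : K) :
  1 + w + w ^+ 2 + w ^+ 3 + w ^+ 4 = 0 ->
  norm5 w (flift K euler) * flift K (stretch (stretch euler)) =
  flift K (stretch euler ^+ 6).
Proof.
move=> w_cyclo; apply: feqP => n.
have e1 : feq n euler (qfact n) by apply: feqW (@feq_euler n).
have e5 : feq n euler (qfact (5 * n)) by apply: (feqW _ (@feq_euler (5 * n))); lia.
apply: (@feq_trans _ _ _ (norm5 w (flift K (qfact (5 * n))) *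
    flift K (stretch (stretch (qfact n))))).
  apply: feqM; first by apply/feq_norm5/feq_flift.
  by apply/feq_flift/feq_stretch/feq_stretch.
rewrite norm5_qfact // [stretch euler ^+ 6]exprS; apply: feq_flift; apply: feq_sym; apply: feqM.
  exact: feq_stretch.
by apply: feqXn; apply: feq_stretch.
Qed.

(** The norm of [E] computed twice, from the product and from the dissection. *)
Lemma euler_modular : stretch euler ^+ 6 = stretch (stretch euler) *
  (euler ^+ 5 + 5 * (q * stretch (stretch euler)) * euler ^+ 4 +
   15 * (q * stretch (stretch euler)) ^+ 2 * euler ^+ 3 +
   25 * (q * stretch (stretch euler)) ^+ 3 * euler ^+ 2 +
   25 * (q * stretch (stretch euler)) ^+ 4 * euler).
Proof.
have [w w_prim] := C_prim_root_exists (isT : 0 < 5)%N.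
have w_cyclo : 1 + w + w ^+ 2 + w ^+ 3 + w ^+ 4 = 0.
  have w1 : w - 1 != 0.
    rewrite subr_eq0; apply/eqP => w1.
    by have := prim_order_dvd w_prim 1; rewrite w1 expr1 eqxx.
  apply: (mulfI w1); rewrite mulr0; transitivity (w ^+ 5 - 1); first by ring.
  by rewrite (prim_expr_order w_prim) subrr.
have inj : injective (flift algC).
  move=> f g e; apply: fpsP => n; apply: (@intr_inj algC).
  exact: (congr1 (fun h : fps algC => h n) e).
apply: inj; rewrite -(euler_norm5 w_cyclo) mulrC rmorphM; congr (_ * _).
(* The middle term of the dissection is [- B], which makes all signs positive. *)
set B := q * stretch (stretch euler).
have cA : inclass 0 (flift algC (stretch euler_0)) by apply/inclass_flift/inclass_stretch.
have cB : inclass 1 (flift algC (- B)).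
  apply/inclass_flift/inclassN; apply: (@inclassM _ 1 0); first exact: (@inclassXn _ 1).
  exact: inclass_stretch.
have cC : inclass 2 (flift algC (q ^+ 2 * stretch euler_2)).
  apply/inclass_flift; apply: (@inclassM _ 2 0); first exact: inclassXn.
  exact: inclass_stretch.
have E3 : flift algC euler = flift algC (stretch euler_0) + flift algC (- B) +
   flift algC (q ^+ 2 * stretch euler_2).
  by rewrite -!rmorphD -euler_dissection.
have AC : flift algC (stretch euler_0) * flift algC (q ^+ 2 * stretch euler_2) =
    - flift algC (- B) ^+ 2.
  rewrite -(rmorphM (flift algC)) -(rmorphXn (flift algC)) -(rmorphN (flift algC)).
  congr (flift algC _); rewrite mulrCA -(rmorphM (@stretch int)) euler_02.
  by rewrite sqrrN exprMn (rmorphN (@stretch int)) (rmorphXn (@stretch int)) mulrN.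
rewrite {1}E3 (norm5_trinomial w_cyclo cA cB cC AC) -E3 (rmorphN (flift algC)).
transitivity (flift algC (euler ^+ 5 + 5 * B * euler ^+ 4 + 15 * B ^+ 2 * euler ^+ 3 +
    25 * B ^+ 3 * euler ^+ 2 + 25 * B ^+ 4 * euler)); last by [].
move: B {cA cB cC AC E3} => B; move: euler => e.
by rewrite !(rmorphD (flift algC)) /= !(rmorphM (flift algC)) /=
  !(rmorph_nat (flift algC)); ring.
Qed.

Local Notation E := euler.
Local Notation E5 := (stretch euler).
Local Notation E25 := (stretch (stretch euler)).

(** * Sections of powers of [hx], expressed in [ht] *)

Definition ieuler := finv euler.
Local Notation J := ieuler.
Local Notation J5 := (stretch ieuler).

Lemma mul_euler : E * J = 1.
Proof. exact/mulfinv/euler_coef0. Qed.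

Lemma mul_euler5 : E5 * J5 = 1.
Proof. by rewrite -rmorphM mul_euler rmorph1. Qed.

Definition hx : fps int := q * E25 * J.
Definition ht : fps int := q * E5 ^+ 6 * J ^+ 6.

Lemma stretch_ht : stretch ht = q ^+ 5 * E25 ^+ 6 * J5 ^+ 6.
Proof. by rewrite /ht !(rmorphM (@stretch int)) /= stretchX. Qed.

Lemma hx_pow6 : hx ^+ 6 = stretch ht * ht.
Proof.
rewrite stretch_ht /hx /ht; have := mul_euler5.
by move: E5 J5 E25 J => e j e' i h; ring: h.
Qed.

(* [hz m] is [stretch ht / hx ^ m], and [fzeta m] below is the section of [hx ^ (- m)]. *)
Definition hz m : fps int := q ^+ (5 - m) * E ^+ m * E25 ^+ (6 - m) * J5 ^+ 6.

(** The modular equation divided by [x^4]. The [hz m] stand for negative powers of [hx], which are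
    not power series, times [t(q^5)]. *)
Lemma hx_hz1 : hx = hz 4 + 5 * hz 3 + 15 * hz 2 + 25 * hz 1 + 25 * hz 0.
Proof.
transitivity (q * E25 * J * J5 ^+ 6 * E5 ^+ 6).
  by have := mul_euler5; rewrite /hx; move: E5 J5 => e j h; ring: h.
rewrite euler_modular /hz /=; have := mul_euler.
by move: E J E25 J5 => e i e' j h; ring: h.
Qed.

Lemma hz_hx m : (0 < m < 5)%N -> hz m * hx = hz m.-1.
Proof.
move=> lt_m; rewrite /hz /hx; have := mul_euler.
have -> : (5 - m.-1 = (5 - m).+1)%N by lia.
have -> : (6 - m.-1 = (6 - m).+1)%N by lia.
case: m lt_m => // m _; rewrite !subSS /= !exprS.
by move: E J E25 J5 (q ^+ _) (_ ^+ (5 - m)) => e i e' j a b h; ring: h.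
Qed.

Lemma hz0 : hz 0 = stretch ht.
Proof. by rewrite stretch_ht /hz subn0 mulr1. Qed.

Lemma hx_pow5 k : hx ^+ k.+4.+1 = stretch ht *
  (hx ^+ k + 5 * hx ^+ k.+1 + 15 * hx ^+ k.+2 + 25 * hx ^+ k.+3 + 25 * hx ^+ k.+4).
Proof.
have := (hz_hx (isT : 0 < 4 < 5), hz_hx (isT : 0 < 3 < 5), hz_hx (isT : 0 < 2 < 5),
         hz_hx (isT : 0 < 1 < 5))%N => /=; case; case; case=> h4 h3 h2 h1.
have := hx_hz1; rewrite -hz0 -h1 -h2 -h3 -h4 !exprS.
move: (hz 4) hx (_ ^+ k) => z x y e.
by transitivity (y * x ^+ 4 * x); [ring | rewrite {2}e; ring].
Qed.

Definition fzeta m : int := [:: 1; -1; -1; 5; -5]`_m.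

(** By the dissection, [q^(5-m) E^m] involves [q^(5-m)] up to [q^(5+m)] with coefficients in [q^5],
    so only [q^5] counts. By [A C = - B^2] its coefficient is a multiple of [B^m], recorded in
    [fzeta]. *)
Lemma pick5_hz m : (m < 5)%N -> pick5 0 (hz m) = (fzeta m)%:~R * ht.
Proof.
move=> lt_m; rewrite /hz.
have e02 := euler_02.
have -> : q ^+ (5 - m) * E ^+ m * E25 ^+ (6 - m) * J5 ^+ 6 =
   stretch (E5 ^+ (6 - m) * J ^+ 6) * (q ^+ (5 - m) * E ^+ m).
  by rewrite rmorphM !(rmorphXn (@stretch int)) /=; ring.
rewrite pick5_mulr // [in X in pick5 0 X]euler_dissection /ht.
move: (J ^+ 6) => j.
set A := euler_0 in e02 *; set C := euler_2 in e02 *; move: E5 e02 => B e02.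
case: m lt_m => [|[|[|[|[|]]]]] //= _; rewrite /fzeta /= ?subSS ?subn0.
- rewrite [X in pick5 0 X](_ : _ = stretch 1 * q ^+ 5); last by rewrite rmorph1; ring.
  by rewrite pick5_sX //= (@pick5_Xn 0 1) //; ring.
- rewrite [X in pick5 0 X](_ : _ = stretch A * q ^+ 4 + stretch (- B) * q ^+ 5 + stretch C * q ^+ 6);
    last by rewrite rmorphN /=; ring.
  by rewrite !(raddfD (@pick5 int 0)) /= !pick5_sX //= (@pick5_Xn 0 1) //; ring.
- rewrite [X in pick5 0 X](_ : _ = stretch (A ^+ 2) * q ^+ 3 + stretch (- 2 * A * B) * q ^+ 4 +
    stretch (B ^+ 2 + 2 * A * C) * q ^+ 5 + stretch (- 2 * B * C) * q ^+ 6 +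
    stretch (C ^+ 2) * q ^+ 7);
    last by rewrite !(rmorphD, rmorphN, rmorphM, rmorphXn, rmorph_nat) /=; ring.
  rewrite !(raddfD (@pick5 int 0)) /= !pick5_sX //= (@pick5_Xn 0 1) //.
  by rewrite -(mulrA 2) e02; ring.
- rewrite [X in pick5 0 X](_ : _ = stretch (A ^+ 3) * q ^+ 2 + stretch (- 3 * A ^+ 2 * B) * q ^+ 3 +
    stretch (3 * A ^+ 2 * C + 3 * A * B ^+ 2) * q ^+ 4 +
    stretch (- B ^+ 3 - 6 * (A * C) * B) * q ^+ 5 +
    stretch (3 * A * C ^+ 2 + 3 * B ^+ 2 * C) * q ^+ 6 +
    stretch (- 3 * B * C ^+ 2) * q ^+ 7 + stretch (C ^+ 3) * q ^+ 8);
    last by rewrite !(rmorphD, rmorphN, rmorphM, rmorphXn, rmorph_nat) /=; ring.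
  rewrite !(raddfD (@pick5 int 0)) /= !pick5_sX //= (@pick5_Xn 0 1) //.
  by rewrite e02; ring.
- rewrite [X in pick5 0 X](_ : _ = stretch (A ^+ 4) * q ^+ 1 + stretch (- 4 * A ^+ 3 * B) * q ^+ 2 +
    stretch (4 * A ^+ 3 * C + 6 * A ^+ 2 * B ^+ 2) * q ^+ 3 +
    stretch (- 4 * A * B ^+ 3 - 12 * A ^+ 2 * C * B) * q ^+ 4 +
    stretch (B ^+ 4 + 12 * (A * C) * B ^+ 2 + 6 * (A * C) ^+ 2) * q ^+ 5 +
    stretch (- 4 * B ^+ 3 * C - 12 * A * B * C ^+ 2) * q ^+ 6 +
    stretch (4 * A * C ^+ 3 + 6 * B ^+ 2 * C ^+ 2) * q ^+ 7 +
    stretch (- 4 * B * C ^+ 3) * q ^+ 8 + stretch (C ^+ 4) * q ^+ 9);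
    last by rewrite !(rmorphD, rmorphN, rmorphM, rmorphXn, rmorph_nat) /=; ring.
  rewrite !(raddfD (@pick5 int 0)) /= !pick5_sX //= (@pick5_Xn 0 1) //.
  by rewrite e02; ring.
Qed.

(* [secpoly k], evaluated at [ht], is the section of the power [hx ^ (k - 4)]; the
   shift by 4 makes the recursion start from constants. *)
Fixpoint secpoly k : {poly int} :=
  match k with
  | 0 => (-5)%:P | 1 => 5%:P | 2 => (-1)%:P | 3 => (-1)%:P | 4 => 1
  | (((((k0.+1) as k1).+1 as k2).+1 as k3).+1 as k4).+1 =>
    'X * (secpoly k0 + 5%:P * secpoly k1 + 15%:P * secpoly k2 + 25%:P * secpoly k3 +
          25%:P * secpoly k4)
  end.

Lemma secpolyS k : secpoly k.+4.+1 =
  'X * (secpoly k + 5%:P * secpoly k.+1 + 15%:P * secpoly k.+2 +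
        25%:P * secpoly k.+3 + 25%:P * secpoly k.+4).
Proof. by []. Qed.

Lemma ind5 (P : nat -> Prop) : P 0%N -> P 1%N -> P 2%N -> P 3%N -> P 4%N ->
  (forall k, P k -> P k.+1 -> P k.+2 -> P k.+3 -> P k.+4 -> P k.+4.+1) ->
  forall k, P k.
Proof.
move=> p0 p1 p2 p3 p4 pS k.
suff: [/\ P k, P k.+1, P k.+2, P k.+3 & P k.+4] by case.
by elim: k => // k [? ? ? ? ?]; split => //; apply: pS.
Qed.

(** Each factor ['X] in the recursion accounts for five more powers of [hx]. *)
Lemma secpoly_low k j : (5 * j + 4 < k)%N -> (secpoly k)`_j = 0.
Proof.
elim/ind5: k j; try by move=> j; lia.
move=> k h0 h1 h2 h3 h4 j lt_jk; rewrite secpolyS coefXM; case: j lt_jk => // j lt_jk /=.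
by rewrite !coefD !coefCM h0 ?h1 ?h2 ?h3 ?h4 ?mulr0 ?addr0 //; lia.
Qed.

Lemma dvdz_exp5M m a b (x y : int) : (m <= a + b)%N ->
  (5%:Z ^+ a %| x)%Z -> (5%:Z ^+ b %| y)%Z -> (5%:Z ^+ m %| x * y)%Z.
Proof.
move=> le_m dx dy; apply: dvdz_trans (dvdz_mul dx dy).
by rewrite -exprD dvdz_exp2l.
Qed.

Lemma dvdz_exp5W m n (x : int) : (m <= n)%N -> (5%:Z ^+ n %| x)%Z -> (5%:Z ^+ m %| x)%Z.
Proof. by move=> le_mn; apply: dvdz_trans; apply: dvdz_exp2l. Qed.

(** Raising [k] by 5 offsets the factor ['X]. Raising it by 1, 2, 3, 4 costs at most 1, 1, 2, 2 in
    the exponent, which the coefficients 5, 15, 25, 25 supply. *)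
Lemma secpoly_dvd k j : (5%:Z ^+ ((5 * j + 3 - k) %/ 2) %| (secpoly k)`_j)%Z.
Proof.
elim/ind5: k j.
1-5: move=> j; rewrite ?[secpoly _]/= ?coefC ?coef1; case: j => [|j] //=; exact: dvdz0.
move=> k h0 h1 h2 h3 h4 j; rewrite secpolyS coefXM; case: j => [|j] /=; first exact: dvdz0.
rewrite !coefD !coefCM !rpredD //.
- by apply: dvdz_exp5W (h0 j); lia.
- by apply: (@dvdz_exp5M _ 1 _ _ _ _ _ (h1 j)); first lia.
- by apply: (@dvdz_exp5M _ 1 _ _ _ _ _ (h2 j)); first lia.
- by apply: (@dvdz_exp5M _ 2 _ _ _ _ _ (h3 j)); first lia.
- by apply: (@dvdz_exp5M _ 2 _ _ _ _ _ (h4 j)); first lia.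
Qed.

(** * Evaluation of integral polynomials at [t] *)

Definition hev (p : {poly int}) : fps int := (map_poly (intr : int -> fps int) p).[ht].

Fact hev_is_zmod_morphism : zmod_morphism hev.
Proof. by move=> p r; rewrite /hev rmorphB hornerD hornerN. Qed.
Fact hev_is_monoid_morphism : monoid_morphism hev.
Proof.
split; first by rewrite /hev rmorph1 hornerC.
by move=> p r; rewrite /hev rmorphM hornerM.
Qed.
HB.instance Definition _ := GRing.isZmodMorphism.Build {poly int} (fps int) hev
  hev_is_zmod_morphism.
HB.instance Definition _ := GRing.isMonoidMorphism.Build {poly int} (fps int) hev
  hev_is_monoid_morphism.

Lemma hevX : hev 'X = ht.
Proof. by rewrite /hev map_polyX hornerX. Qed.

Lemma hevC c : hev c%:P = c%:~R.
Proof. by rewrite /hev map_polyC hornerC. Qed.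

Lemma hevZ c p : hev (c *: p) = c%:~R * hev p.
Proof. by rewrite -mul_polyC rmorphM /= hevC. Qed.

Lemma hevE p : hev p = \sum_(i < size p) (p`_i)%:~R * ht ^+ i.
Proof.
rewrite -{1}[p]coefK poly_def rmorph_sum; apply: eq_bigr => i _.
by rewrite /= hevZ rmorphXn /= hevX.
Qed.

(** From the fifth power on, this is the modular equation. For the powers 1 to 4 the recursion
    reaches negative powers, handled through [hz] and [pick5_hz]. *)
Lemma pick5_hx k : pick5 0 (hx ^+ k) = hev (secpoly (k + 4)).
Proof.
have C (c : int) : c%:~R = stretch (c%:~R : fps int) by rewrite rmorph_int.
have Cn c (f : fps int) : pick5 0 (c%:R * f) = c%:R * pick5 0 f.
  by rewrite -pick5_mulr // rmorph_nat.
have S k' : pick5 0 (hx ^+ k'.+4.+1) = ht * (pick5 0 (hx ^+ k') +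
   5 * pick5 0 (hx ^+ k'.+1) + 15 * pick5 0 (hx ^+ k'.+2) +
   25 * pick5 0 (hx ^+ k'.+3) + 25 * pick5 0 (hx ^+ k'.+4)).
  by rewrite hx_pow5 pick5_mulr // !(raddfD (@pick5 int 0)) /= !Cn.
have Hz m : (m < 5)%N -> pick5 0 (hz m) = (fzeta m)%:~R * ht by exact: pick5_hz.
have h4 := hz_hx (isT : 0 < 4 < 5)%N; have h3 := hz_hx (isT : 0 < 3 < 5)%N.
have h2 := hz_hx (isT : 0 < 2 < 5)%N; have h1 := hz_hx (isT : 0 < 1 < 5)%N.
have u0 : pick5 0 (hx ^+ 0) = hev (secpoly 4).
  transitivity (pick5 0 (stretch (1 : fps int))); first by rewrite rmorph1.
  by rewrite pick5_stretch /= rmorph1.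
have V p0 p1 p2 p3 p4 : hev ('X * (p0 + 5%:P * p1 + 15%:P * p2 + 25%:P * p3 + 25%:P * p4)) =
   ht * (hev p0 + 5 * hev p1 + 15 * hev p2 + 25 * hev p3 + 25 * hev p4).
  by rewrite rmorphM !(rmorphD hev) /= !(rmorphM hev) /= !hevC hevX.
have x1 : pick5 0 (hx ^+ 1) = hev (secpoly 5).
  rewrite secpolyS V !hevC expr1 {1}hx_hz1 !(raddfD (@pick5 int 0)) /= !Cn !Hz //.
  rewrite /fzeta /= rmorph1; ring.
have hz_x2 : hx ^+ 2 = hz 3 + 5 * hz 2 + 15 * hz 1 + 25 * hz 0 + 25 * (stretch ht * hx).
  rewrite expr2 {1}hx_hz1 -hz0; move: h4 h3 h2 h1 => /= <- <- <- <-.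
  by move: (hz 4) hx (stretch ht) => z x u; ring.
have hz_x3 : hx ^+ 3 = hz 2 + 5 * hz 1 + 15 * hz 0 + 25 * (stretch ht * hx) +
    25 * (stretch ht * hx ^+ 2).
  rewrite exprS {1}hz_x2 -hz0; move: h4 h3 h2 h1 => /= <- <- <- <-.
  by move: (hz 4) hx (stretch ht) => z x u; ring.
have hz_x4 : hx ^+ 4 = hz 1 + 5 * hz 0 + 15 * (stretch ht * hx) +
    25 * (stretch ht * hx ^+ 2) + 25 * (stretch ht * hx ^+ 3).
  rewrite exprS {1}hz_x3 -hz0; move: h4 h3 h2 h1 => /= <- <- <- <-.
  by move: (hz 4) hx (stretch ht) => z x u; ring.
have x2 : pick5 0 (hx ^+ 2) = hev (secpoly 6).
  rewrite secpolyS V -x1 !hevC hz_x2 !(raddfD (@pick5 int 0)) /= !Cn !Hz // pick5_mulr //.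
  by rewrite /fzeta /= rmorph1 expr1; ring.
have x3 : pick5 0 (hx ^+ 3) = hev (secpoly 7).
  rewrite secpolyS V -x1 -x2 !hevC hz_x3 !(raddfD (@pick5 int 0)) /= !Cn !Hz // !pick5_mulr //.
  by rewrite /fzeta /= rmorph1 expr1; ring.
have x4 : pick5 0 (hx ^+ 4) = hev (secpoly 8).
  rewrite secpolyS V -x1 -x2 -x3 !hevC hz_x4 !(raddfD (@pick5 int 0)) /= !Cn !Hz // !pick5_mulr //.
  by rewrite /fzeta /= rmorph1 expr1; ring.
elim/ind5: k => // k e0 e1 e2 e3 e4.
by rewrite S e0 e1 e2 e3 e4 -V.
Qed.

(** [ht] is [q] times an invertible series. *)
Lemma ht_inj k (f g : fps int) : ht ^+ k * f = ht ^+ k * g -> f = g.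
Proof.
have u : ht ^+ k * (J5 ^+ (6 * k) * E ^+ (6 * k)) = q ^+ k.
  rewrite /ht !exprM -!exprMn; congr (_ ^+ k).
  have := (mul_euler, mul_euler5); case.
  by move: E J E5 J5 => e j e' j' h h'; ring: h h'.
move=> e; apply: (@fXn_inj _ k); rewrite -!u mulrAC e; ring.
Qed.

Lemma hev_drop k (p : {poly int}) : (forall j, (j < k)%N -> p`_j = 0) ->
  hev p = ht ^+ k * hev (drop_poly k p).
Proof.
move=> p0; rewrite -{1}[p](poly_take_drop k) (_ : take_poly k p = 0).
  by rewrite add0r rmorphM rmorphXn /= hevX mulrC.
by apply/polyP => j; rewrite coef_take_poly coef0; case: ifP => // /p0.
Qed.

(** * The two steps between successive progressions, with their 5-adic bounds *)

Definition odd_step (Y : {poly int}) : {poly int} :=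
  \sum_(i < size Y) Y`_i *: drop_poly i (secpoly (6 * i + 11)).

Definition even_step (X : {poly int}) : {poly int} :=
  \sum_(l < size X) X`_l *: drop_poly l (secpoly (6 * l + 4)).

Lemma pick5Z r (c : int) (f : fps int) : (r < 5)%N ->
  pick5 r (c%:~R * f) = c%:~R * pick5 r f.
Proof. by move=> lt_r; rewrite -pick5_mulr // rmorph_int. Qed.

(** After multiplication by [t^i] and with [E5^7] moved inside, the section of [q^7 t^i / E^7]
    becomes that of [x^(6 i + 7)], since [x^6 = t(q) t(q^5)]. Its low coefficients vanish, so
    dividing by [t^i] means dropping them. *)
Lemma odd_stepE (f : fps int) Y : f * E ^+ 7 = hev Y ->
  pick5 0 (q ^+ 7 * f) * E5 ^+ 7 = hev (odd_step Y).
Proof.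
move=> fY; have {fY} -> : f = J ^+ 7 * hev Y.
  by rewrite -fY; have := mul_euler; move: E J => e j h; ring: h.
rewrite hevE !mulr_sumr raddf_sum mulr_suml rmorph_sum; apply: eq_bigr => -[i lt_i] _ /=.
rewrite hevZ [X in pick5 0 X](_ : _ = (Y`_i)%:~R * (q ^+ 7 * (ht ^+ i * J ^+ 7))); last by ring.
rewrite pick5Z // -mulrA; congr (_ * _).
apply: (@ht_inj i); rewrite -hev_drop; last first.
  by move=> j lt_ji; apply: secpoly_low; move: lt_ji {lt_i}; clear; lia.
rewrite (_ : 6 * i + 11 = (6 * i + 7) + 4)%N; last by lia.
rewrite -pick5_hx exprD exprM hx_pow6.
transitivity (pick5 0 (stretch (ht ^+ i * E5 ^+ 7) * (q ^+ 7 * (ht ^+ i * J ^+ 7)))).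
  by rewrite pick5_mulr //; ring.
congr (pick5 0 _); rewrite rmorphM !(rmorphXn (@stretch int)) /= [(stretch ht * ht) ^+ i]exprMn.
by move: (stretch ht) ht; rewrite /hx => a b; ring.
Qed.

Lemma even_stepE (g : fps int) X : g * E5 ^+ 7 = hev X ->
  pick5 0 g * E ^+ 7 = hev (even_step X).
Proof.
move=> gX; have {gX} -> : g = stretch (J ^+ 7) * hev X.
  by rewrite -gX rmorphXn /=; have := mul_euler5; move: E5 J5 => e j h; ring: h.
rewrite pick5_mulr // mulrAC (_ : J ^+ 7 * E ^+ 7 = 1) ?mul1r; last first.
  by rewrite -exprMn mulrC mul_euler expr1n.
rewrite hevE raddf_sum rmorph_sum; apply: eq_bigr => -[l lt_l] _ /=.
rewrite hevZ pick5Z //; congr (_ * _).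
apply: (@ht_inj l); rewrite -hev_drop; last by move=> j lt_jl; apply: secpoly_low; lia.
by rewrite -pick5_hx exprM hx_pow6 [(stretch ht * ht) ^+ l]exprMn -(rmorphXn (@stretch int)) /= pick5_mulr.
Qed.

(** [(5 l - 8) / 2] is the exponent that [secpoly_dvd] gives for [secpoly 11], the first polynomial.
    It is 1 at [l = 2] and at least 3 beyond, which singles out the [t^2] term. *)
Definition odd_bound a (X : {poly int}) : Prop :=
  [/\ X`_0 = 0, X`_1 = 0 &
    forall l, (5%:Z ^+ (a + (5 * l - 8) %/ 2) %| X`_l)%Z].

(** The bound inherited from the term [l = 2] of [even_step]: [5^(a+1)] from the coefficient of
    [t^2], the rest from coefficient [i + 2] of [secpoly 16]. *)
Definition even_bound a (Y : {poly int}) : Prop :=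
  Y`_0 = 0 /\ forall i, (5%:Z ^+ (a.+1 + (5 * i - 3) %/ 2) %| Y`_i)%Z.

Lemma coef_step (Y : {poly int}) c l :
  (\sum_(i < size Y) Y`_i *: drop_poly i (secpoly (6 * i + c)))`_l =
  \sum_(i < size Y) Y`_i * (secpoly (6 * i + c))`_(l + i).
Proof. by rewrite coef_sum; apply: eq_bigr => i _; rewrite coefZ coef_drop_poly. Qed.

Lemma odd_bound1 : odd_bound 0 (odd_step 1).
Proof.
have -> : odd_step 1 = secpoly 11.
  by rewrite /odd_step size_poly1 big_ord1 coef1 scale1r drop_poly0l.
split=> [||l]; [exact: secpoly_low | exact: secpoly_low |].
by apply: dvdz_exp5W (secpoly_dvd 11 l); lia.
Qed.

Lemma even_step_bound a X : odd_bound a X -> even_bound a (even_step X).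
Proof.
move=> [X0 X1 Xl]; split=> [|i]; rewrite /even_step coef_step.
  apply: big1 => -[l lt_l] _ /=; case: l lt_l => [|l] lt_l; first by rewrite X0 mul0r.
  by rewrite secpoly_low ?mulr0 //; lia.
apply: rpred_sum => -[l lt_l] _ /=.
case: (ltnP (5 * i) l) => [lt_il|le_li].
  by rewrite secpoly_low ?mulr0 ?dvdz0 //; lia.
case: l {lt_l} le_li => [|[|l]] le_li; rewrite ?X0 ?X1 ?mul0r ?dvdz0 //.
(* Equality occurs at [l = 2]. At [l = i = 1] the exponents would fall short, whence [X1] in the
   invariant. *)
apply: dvdz_exp5M (Xl _) (secpoly_dvd _ _); lia.
Qed.

Lemma odd_step_bound a Y : even_bound a Y -> odd_bound a.+1 (odd_step Y).
Proof.
move=> [Y0 Yi].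
have low l : (l < 2)%N -> (odd_step Y)`_l = 0.
  move=> lt_l; rewrite /odd_step coef_step; apply: big1 => -[i lt_i] _ /=.
  case: i lt_i => [|i] lt_i; first by rewrite Y0 mul0r.
  by rewrite secpoly_low ?mulr0 //; lia.
split=> [||l]; [exact: low | exact: low |].
rewrite /odd_step coef_step; apply: rpred_sum => -[i lt_i] _ /=.
case: (ltnP (5 * l + 1) (i + 8)) => [lt_li|le_il].
  case: (ltnP (5 * l) (i + 7)) => [lt_li'|le_il]; last by lia.
  by rewrite secpoly_low ?mulr0 ?dvdz0 //; lia.
case: i {lt_i} le_il => [|i] le_il; rewrite ?Y0 ?mul0r ?dvdz0 //.
apply: dvdz_exp5M (Yi _) (secpoly_dvd _ _); lia.
Qed.

(** * The generating function of colored partitions *)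

Lemma feq_ieuler n : feq n.+1 ieuler (iqfact n).
Proof.
apply: (@feq_trans _ _ _ (J * (qfact n * iqfact n))); first by rewrite mul_iqfact mulr1.
apply: (@feq_trans _ _ _ (J * (E * iqfact n))).
  by apply: feqM => //; apply: feqM => //; apply: feq_sym; apply: feq_euler.
by rewrite mulrA [J * E]mulrC mul_euler mul1r.
Qed.

Lemma feq_prod n (I : Type) (r : seq I) (F G : I -> fps int) :
  (forall i, feq n (F i) (G i)) -> feq n (\prod_(i <- r) F i) (\prod_(i <- r) G i).
Proof.
by move=> e; elim/big_ind2: _ => // f f' g g'; exact: feqM.
Qed.

(** Multiplied by [qfact n], the truncated geometric series leave factors [1 - q^((n+1)(i+1))], all
    1 modulo [q^(n+1)]. *)
Lemma feq_geom n : feq n.+1 (\prod_(i < n) \sum_(j < n.+1) q ^+ (j * i.+1)) J.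
Proof.
apply: (@feq_trans _ _ _ (iqfact n)); last by apply: feq_sym; exact: feq_ieuler.
set G := \prod_(i < n) _.
have G1 : feq n.+1 (G * qfact n) 1.
  rewrite -big_split /=; apply: (@feq_trans _ _ _ (\prod_(i < n) 1)); last by rewrite big1_eq.
  apply: feq_prod => i; rewrite mulrC.
  rewrite (_ : \sum_(j < n.+1) _ = \sum_(j < n.+1) (q ^+ i.+1) ^+ j); last first.
    by apply: eq_bigr => j _; rewrite -exprM mulnC.
  move=> m lt_m; rewrite -[1 - _]opprB mulNr -subrX1 opprB fcoefB -exprM fcoefXn.
  by rewrite (_ : m == _ = false) ?subr0 //; apply/eqP; nia.
apply: (@feq_trans _ _ _ (G * qfact n * iqfact n)); first by rewrite -mulrA mul_iqfact mulr1.
by rewrite -[X in feq _ _ X]mul1r; apply: feqM.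
Qed.

(** Expanding the product over parts and colors selects one multiplicity for each pair, that is, one
    function [m]. *)
Lemma num_colored_partitionsE k n : (num_colored_partitions k n)%:Z = (J ^+ k) n.
Proof.
have e : feq n.+1 (\prod_(u : 'I_n * 'I_k) \sum_(j < n.+1) q ^+ (j * u.1.+1)) (J ^+ k).
  rewrite -(pair_bigA _ (fun (i : 'I_n) (_ : 'I_k) => \sum_(j < n.+1) q ^+ (j * i.+1))) /=.
  under eq_bigr do rewrite big_const_ord iter_mulr_1.
  by rewrite prodrXl; apply: feqXn; exact: feq_geom.
rewrite -e // bigA_distr_bigA fcoef_sum /num_colored_partitions -sum1_card.
rewrite (big_morph Posz PoszD (erefl _)) big_mkcond; apply: eq_bigr => m _.
by rewrite inE -expr_sum fcoefXn eq_sym; case: eqP.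
Qed.

(** * The progressions of the theorem as iterated sections *)

Lemma pick5_shift a b r (f : fps int) : (r < 5)%N -> (5 * a = b + r)%N ->
  pick5 0 (q ^+ b * f) = q ^+ a * pick5 r f.
Proof.
move=> lt_r ab; apply: fpsP => n.
rewrite -[LHS]/((q ^+ b * f) (5 * n + 0)%N) !fcoefXnM -[pick5 r f _]/(f (5 * (n - a) + r)%N).
have -> : (5 * n + 0 < b)%N = (n < a)%N by lia.
by case: ltnP => // le_an; congr (f _); lia.
Qed.

(* The series of the [p_{-7}(5^(2a+1) n + delta)] with [delta = (13 * 5^(2a+1) + 7) / 24]. *)
Fixpoint godd a : fps int :=
  if a is b.+1 then pick5 2 (pick5 3 (godd b)) else pick5 3 (J ^+ 7).

(** The induction starts from [J^7 E^7 = 1], the value of the polynomial 1. The powers of [q] turn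
    each section into one at residue 0: [10 = 7 + 3] at the start, then [5 = 2 + 3] and [10 = 8 + 2]
    alternately. *)
Lemma godd_hev a : exists2 X, odd_bound a X & q ^+ 2 * godd a * E5 ^+ 7 = hev X.
Proof.
elim: a => [|a [X bX eX]].
  exists (odd_step 1); first exact: odd_bound1.
  rewrite -(@odd_stepE (J ^+ 7)) ?(@pick5_shift 2 7 3) //.
  by rewrite -exprMn mulrC mul_euler expr1n rmorph1.
exists (odd_step (even_step X)); first exact/odd_step_bound/even_step_bound.
rewrite -(@odd_stepE (q * pick5 3 (godd a))).
  by rewrite mulrA -exprSr (@pick5_shift 2 8 2).
by rewrite -(even_stepE eX) (@pick5_shift 1 2 3).
Qed.

Lemma geven_hev a :
  exists2 Y, even_bound a Y & q * pick5 3 (godd a) * E ^+ 7 = hev Y.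
Proof.
have [X bX eX] := godd_hev a; exists (even_step X); first exact: even_step_bound.
by rewrite -(even_stepE eX) (@pick5_shift 1 2 3).
Qed.

(** * Divisibility of the coefficients, and the congruences *)

Definition fdvd (d : int) (f : fps int) : Prop := forall n, (d %| f n)%Z.

Lemma fdvdMr d f g : fdvd d f -> fdvd d (f * g).
Proof. by move=> df n; rewrite fcoefM rpred_sum // => i _; rewrite dvdz_mulr. Qed.

Lemma fdvdD d f g : fdvd d f -> fdvd d g -> fdvd d (f + g).
Proof. by move=> df dg n; rewrite fcoefD rpredD. Qed.

Lemma fcoef_intM (c : int) (f : fps int) n : (c%:~R * f) n = c * f n.
Proof.
have P (m : nat) : ((m%:~R : fps int) * f) n = m%:Z * f n.
  by rewrite -pmulrn mulr_natl fcoefMn -mulr_natl natz.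
case: c => m; first exact: P.
by rewrite NegzE mulrNz mulNr fcoefN P mulNr.
Qed.

Lemma fdvd_intM (d c : int) f : (d %| c)%Z -> fdvd d (c%:~R * f).
Proof. by move=> dc n; rewrite fcoef_intM dvdz_mulr. Qed.

Lemma fdvd_hev d (X : {poly int}) : (forall l, (d %| X`_l)%Z) -> fdvd d (hev X).
Proof.
move=> dX; rewrite hevE; elim/big_ind: _ => [n||i _]; first exact: dvdz0.
  exact: fdvdD.
exact: fdvd_intM.
Qed.

Lemma fdvd_XnM d k f : fdvd d (q ^+ k * f) -> fdvd d f.
Proof. by move=> df n; have := df (n + k)%N; rewrite fcoefXnM addnK ltnNge leq_addl. Qed.

Lemma godd_dvd a : fdvd (5%:Z ^+ a.+1) (godd a).
Proof.
have [X [X0 X1 bX] eX] := godd_hev a; apply: (@fdvd_XnM _ 2).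
have -> : q ^+ 2 * godd a = hev X * J5 ^+ 7.
  by rewrite -eX; have := mul_euler5; move: E5 J5 => e j h; ring: h.
apply/fdvdMr/fdvd_hev => -[|[|l]]; rewrite ?X0 ?X1 ?dvdz0 //.
by apply: dvdz_exp5W (bX _); lia.
Qed.

Lemma geven_dvd a : fdvd (5%:Z ^+ a.+2) (pick5 3 (godd a)).
Proof.
have [Y [Y0 bY] eY] := geven_hev a; apply: (@fdvd_XnM _ 1); rewrite expr1.
have -> : q * pick5 3 (godd a) = hev Y * J ^+ 7.
  by rewrite -eY; have := mul_euler; move: E J => e j h; ring: h.
apply/fdvdMr/fdvd_hev => -[|l]; rewrite ?Y0 ?dvdz0 //.
by apply: dvdz_exp5W (bY _); lia.
Qed.

(** [t^2 / E5^7] is [q^2 E5^5 J^12]. Modulo 5 the modular equation reads [J^5 = E25 J5^6], and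
    [J^12 = E^3 (J^5)^3]. *)
Lemma ieuler12_mod5 : exists h,
  E5 ^+ 5 * J ^+ 12 = stretch (E ^+ 5 * (E5 * J ^+ 6) ^+ 3) * E ^+ 3 + 5 * h.
Proof.
have [h Eh] : exists h, J ^+ 5 = E25 * J5 ^+ 6 + 5 * h.
  (* The terms [5 x + 15 x^2 + 25 x^3 + 25 x^4] of the modular equation, divided by 5. *)
  exists (E25 * J5 ^+ 6 * ((q * E25) * J + 3 * (q * E25) ^+ 2 * J ^+ 2 +
     5 * (q * E25) ^+ 3 * J ^+ 3 + 5 * (q * E25) ^+ 4 * J ^+ 4)).
  transitivity (J ^+ 5 * J5 ^+ 6 * E5 ^+ 6).
    by have := mul_euler5; move: E5 J5 => e j h; ring: h.
  rewrite euler_modular; have := mul_euler.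
  by move: E J E25 J5 => e j e' j' h; ring: h.
pose A := E25 * J5 ^+ 6.
(* From [((A + 5 h)^3 - A^3) / 5]. *)
exists (E5 ^+ 5 * E ^+ 3 * h * (3 * A ^+ 2 + 15 * A * h + 25 * h ^+ 2)).
rewrite !(rmorphM (@stretch int), rmorphXn (@stretch int)) /= -/A.
transitivity (E5 ^+ 5 * E ^+ 3 * (J ^+ 5) ^+ 3).
  by have := mul_euler; move: E J (E5 ^+ 5) => e j x H; ring: H.
by rewrite Eh -/A; ring.
Qed.

Lemma godd_dvd24 a r : r \in [:: 2; 4]%N -> fdvd (5%:Z ^+ a.+2) (pick5 r (godd a)).
Proof.
move=> r24; have lt_r : (r < 5)%N by move: r24; rewrite !inE => /orP[] /eqP ->.
have [X [X0 X1 bX] eX] := godd_hev a.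
have [h Eh] := ieuler12_mod5.
have X2 : X = X`_2 *: 'X^2 + (X - X`_2 *: 'X^2) by rewrite addrC subrK.
have dX : fdvd (5%:Z ^+ a.+2) (hev (X - X`_2 *: 'X^2)).
  apply: fdvd_hev => -[|[|[|l]]]; rewrite coefB coefZ coefXn /=.
  - by rewrite X0 mulr0 subrr dvdz0.
  - by rewrite X1 mulr0 subrr dvdz0.
  - by rewrite mulr1 subrr dvdz0.
  - by rewrite mulr0 subr0; apply: dvdz_exp5W (bX _); lia.
have e : q ^+ 2 * godd a = q ^+ 2 * ((X`_2)%:~R * (E5 ^+ 5 * J ^+ 12)) +
    hev (X - X`_2 *: 'X^2) * J5 ^+ 7.
  transitivity (hev X * J5 ^+ 7).
    by rewrite -eX; have := mul_euler5; move: E5 J5 => e j H; ring: H.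
  rewrite {1}X2 rmorphD /= mulrDl hevZ rmorphXn /= hevX /ht; congr (_ + _).
  by have := mul_euler5; move: E5 J5 => e j H; ring: H.
have [c Ec] : exists c, X`_2 = 5%:Z ^+ a.+1 * c.
  have /dvdzP[c ->] : (5%:Z ^+ a.+1 %| X`_2)%Z by apply: dvdz_exp5W (bX 2); lia.
  by exists c; rewrite mulrC.
(* [X_2] carries [5^(a+1)], and replacing [E5^5 J^12] by its residue modulo 5 costs a multiple of
   5. *)
have dg : fdvd (5%:Z ^+ a.+2) (godd a - (5%:Z ^+ a.+1 * c)%:~R * (stretch (E ^+ 5 * (E5 * J ^+ 6) ^+ 3) * E ^+ 3)).
  apply: (@fdvd_XnM _ 2); rewrite mulrBr e Eh -Ec.
  rewrite (_ : _ - _ = (X`_2 * 5)%:~R * (q ^+ 2 * h) +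
     hev (X - X`_2 *: 'X^2) * J5 ^+ 7); last by rewrite rmorphM /=; ring.
  apply: fdvdD; last exact: fdvdMr.
  by apply: fdvd_intM; rewrite Ec mulrAC -exprSr dvdz_mulr.
move=> n; have := dg (5 * n + r)%N; rewrite fcoefB fcoef_intM.
rewrite -[(stretch _ * _) _]/(pick5 r (stretch _ * _) n) pick5_mulr // pick5_euler3 //.
by rewrite mulr0 fcoef0 mulr0 subr0.
Qed.

(** With [s = (25^a - 1) / 24], the offset [65 s + 3] is [(13 * 5^(2a+1) + 7) / 24]. *)
Lemma godd_num a s n : (25 ^ a = 24 * s + 1)%N ->
  godd a n = (num_colored_partitions 7 (5 * 25 ^ a * n + 65 * s + 3))%:Z.
Proof.
rewrite num_colored_partitionsE; elim: a s n => [|a IH] s n Es.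
  have -> : s = 0%N by move: Es; rewrite expn0; lia.
  by congr ((J ^+ 7) _); rewrite expn0; lia.
have [s' Es'] : exists s', (25 ^ a = 24 * s' + 1)%N.
  by exists ((s - 1) %/ 25)%N; move: Es; rewrite expnS; lia.
rewrite -[LHS]/(godd a (5 * (5 * n + 2) + 3)%N) (IH s') //; congr ((J ^+ 7) _).
move: Es; rewrite expnS Es'; nia.
Qed.

Lemma modn_dvdz m d : (d%:Z %| m%:Z)%Z -> m = 0 %[mod d].
Proof. by rewrite dvdzE /= => /eqP ->; rewrite mod0n. Qed.

Local Close Scope ring_scope.

Theorem theorem1p4 (n alpha : nat) (halpha : 1 <= alpha) :
  [/\ num_colored_partitions 7
        (5 ^ (2 * alpha - 1) * n + (13 * 5 ^ (2 * alpha - 1) + 7) %/ 24)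
        = 0 %[mod 5 ^ alpha],
      num_colored_partitions 7
        (5 ^ (2 * alpha) * n + (17 * 5 ^ (2 * alpha) + 7) %/ 24)
        = 0 %[mod 5 ^ (alpha + 1)],
      num_colored_partitions 7
        (5 ^ (2 * alpha) * n + (61 * 5 ^ (2 * alpha - 1) + 7) %/ 24)
        = 0 %[mod 5 ^ (alpha + 1)]
    & num_colored_partitions 7
        (5 ^ (2 * alpha) * n + (109 * 5 ^ (2 * alpha - 1) + 7) %/ 24)
        = 0 %[mod 5 ^ (alpha + 1)]].
Proof.
case: alpha halpha => // a _.
have -> : 2 * a.+1 - 1 = (2 * a).+1 by lia.
have -> : 2 * a.+1 = (2 * a).+2 by lia.
rewrite addn1 (expnS 5 (2 * a).+1) (expnS 5 (2 * a)) (expnM 5 2 a) -[5 ^ 2]/25.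
have [s Es] : exists s, 25 ^ a = 24 * s + 1.
  elim: a => [|a [s IH]]; first by exists 0.
  by exists (25 * s + 1); rewrite expnS IH; lia.
have P m k (f : fps int) r : fdvd (GRing.exp 5%:Z k) f ->
    f n = Posz (num_colored_partitions 7 r) -> m = r ->
    num_colored_partitions 7 m = 0 %[mod 5 ^ k].
  move=> df e ->; apply: modn_dvdz; rewrite -e.
  by have := df n; rewrite -rmorphXn natrXE.
(* The residues 3, 2 and 4 give the offsets of the last three congruences, in this order. *)
have Q r : pick5 r (godd a) n =
    Posz (num_colored_partitions 7 (5 * 25 ^ a * (5 * n + r) + 65 * s + 3)).
  exact: godd_num.
split.
- apply: (P _ _ _ _ (godd_dvd a) (godd_num n Es)); rewrite Es; nia.
- apply: (P _ _ _ _ (geven_dvd a) (Q 3)); rewrite Es; nia.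
- apply: (P _ _ _ _ (@godd_dvd24 a 2 isT) (Q 2)); rewrite Es; nia.
- apply: (P _ _ _ _ (@godd_dvd24 a 4 isT) (Q 4)); rewrite Es; nia.
Qed.
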